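(* If $k\geq 1$ and $\ell\in\{1,\ldots,2k+1\}$, then there are exactly $A_{k+1}(\ell)$ uniquely sorted permutations in $S_{2k+1}$ with eye $\ell-1$.
   Context: $S_n$ is the set of permutations of $\{1,\ldots,n\}$, written as words $\pi=\pi_1\cdots\pi_n$. The (West) stack-sorting map $s:S_n\to S_n$ is defined by the following procedure on an input $\pi=\pi_1\cdots\pi_n$, using an initially empty vertical stack. At any point in time, if there is a next entry of the input and either it is smaller than the entry at the top of the stack or the stack is empty, then that next entry is placed on top of the stack. Otherwise, the entry at the top of the stack is removed and appended to the end of the output. The procedure terminates when the output has length $n$, and $s(\pi)$ is this output. A permutation $\pi\in S_n$ is uniquely sorted if $|s^{-1}(\pi)|=1$. $A_{k+1}(\ell)$ denotes the number of uniquely sorted permutations $\pi\in S_{2k+1}$ with first entry $\pi_1=\ell$. A descent of $\pi$ is an index $i\in\{1,\ldots,n-1\}$ with $\pi_i>\pi_{i+1}$. The plot of $\pi$ is the set of points $(i,\pi_i)$. A hook of $\pi$ is given by a southwest endpoint $(i,\pi_i)$ and a northeast endpoint $(j,\pi_j)$ with $i<j$ and $\pi_i<\pi_j$; it is the L-shaped set $(\{i\}\times[\pi_i,\pi_j])\cup([i,j]\times\{\pi_j\})$. If $\pi$ has descents $d_1<\cdots<d_k$, a valid hook configuration of $\pi$ is a tuple $(H_1,\ldots,H_k)$ of hooks of $\pi$ such that: (1) for each $i$, the southwest endpoint of $H_i$ is $(d_i,\pi_{d_i})$; (2) no point of the plot lies directly above a hook (i.e., if a hook has endpoints $(i,\pi_i)$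 and $(j,\pi_j)$ and $i<l<j$, then $\pi_l<\pi_j$); (3) hooks do not intersect each other, except that the northeast endpoint of one hook may be the southwest endpoint of another. Each uniquely sorted permutation $\pi\in S_{2k+1}$ has a unique valid hook configuration $\mathcal H$, and for $k\ge1$ it has at least one hook. The top hook of $\mathcal H$ is the hook whose northeast endpoint is farthest north. The sheltered piece of $\mathcal H$ consists of all points and hooks lying strictly underneath the top hook (so its points are the $(l,\pi_l)$ with $l$ strictly between the abscissas of the two endpoints of the top hook). If $(j,\pi_j)$ is the leftmost point in the sheltered piece, then $\pi_j$ is called the eye of $\pi$. *)

(* Defs.v *)
From HB Require Import structures.
From mathcomp Require Import all_boot all_order all_fingroup all_algebra.
From mathcomp Require Import boolp classical_sets set_interval reals.

Set Implicit Arguments.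
Unset Strict Implicit.
Unset Printing Implicit Defensive.

(* An element of S_n is a permutation of 'I_n = {0, ..., n-1}.  Abscissas and
   entries are shifted by one in [word], [abscissa] and [entry], so that they
   range over {1, ..., n}; indices such as descents stay in 'I_n. *)

Definition entry n (p : 'S_n) (i : 'I_n) : nat := (p i).+1.

Definition abscissa n (i : 'I_n) : nat := i.+1.

Definition word n (p : 'S_n) : seq nat := [seq entry p i | i <- enum 'I_n].

(* The state is (remaining input, stack with its top first, output). *)
Definition stack_step (st : seq nat * seq nat * seq nat) :=
  let: (inp, stk, out) := st in
  match inp, stk with
  | x :: inp', [::] => (inp', [:: x], out)
  | x :: inp', y :: stk' =>
      if (x < y)%N then (inp', x :: stk, out) else (inp, stk', rcons out y)
  | [::], y :: stk' => ([::], stk', rcons out y)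
  | [::], [::] => st
  end.

(* Each entry is pushed once and popped once, so the output is complete after
   exactly [2 * size w] steps. *)
Definition stack_sort (w : seq nat) : seq nat :=
  (iter (2 * size w) stack_step (w, [::], [::])).2.

Definition preimages n (p : 'S_n) : pred 'S_n :=
  [pred q : 'S_n | stack_sort (word q) == word p].

Definition uniquely_sorted n (p : 'S_n) : bool := #|preimages p| == 1%N.

(* A_m(l) is only defined for m = k + 1 >= 1; the value at m = 0 is junk. *)
Definition A (m l : nat) : nat :=
  if m is k.+1 then
    #|[pred p : 'S_(2 * k + 1) | uniquely_sorted p & head 0%N (word p) == l]|
  else 0%N.

Definition is_descent n (p : 'S_n) (i : 'I_n) : bool :=
  [exists j : 'I_n, (j == i.+1 :> nat) && (entry p j < entry p i)%N].

Definition descents n (p : 'S_n) : seq 'I_n :=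
  [seq i <- enum 'I_n | is_descent p i].

Section Plane.
Local Open Scope ring_scope.
Local Open Scope classical_set_scope.

Definition plot_point (R : realType) n (p : 'S_n) (i : 'I_n) : R * R :=
  ((abscissa i)%:R, (entry p i)%:R).

(* A hook is encoded by the indices of its southwest and northeast
   endpoints. *)
Definition is_hook n (p : 'S_n) (h : 'I_n * 'I_n) : bool :=
  (h.1 < h.2)%N && (entry p h.1 < entry p h.2)%N.

Definition hook_shape (R : realType) n (p : 'S_n) (h : 'I_n * 'I_n) :
    set (R * R) :=
  let x1 : R := (abscissa h.1)%:R in let y1 : R := (entry p h.1)%:R in
  let x2 : R := (abscissa h.2)%:R in let y2 : R := (entry p h.2)%:R in
  ([set x1] `*` `[y1, y2]) `|` (`[x1, x2] `*` [set y2]).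

Definition valid_hook_configuration (R : realType) n (p : 'S_n)
    (H : seq ('I_n * 'I_n)) : Prop :=
  [/\ (forall h, h \in H -> is_hook p h),
      [seq h.1 | h <- H] = descents p,
      (forall h (l : 'I_n), h \in H -> (h.1 < l < h.2)%N ->
         (entry p l < entry p h.2)%N)
    & (forall h h' (z : R * R), h \in H -> h' \in H -> h != h' ->
         hook_shape p h z -> hook_shape p h' z ->
         (z = plot_point R p h.2 /\ z = plot_point R p h'.1) \/
         (z = plot_point R p h.1 /\ z = plot_point R p h'.2))].

End Plane.

Definition is_top_hook n (p : 'S_n) (H : seq ('I_n * 'I_n))
    (t : 'I_n * 'I_n) : Prop :=
  t \in H /\ forall h, h \in H -> (entry p h.2 <= entry p t.2)%N.

(* The indices of the points of the sheltered piece below the top hook [t]. *)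
Definition sheltered n (t : 'I_n * 'I_n) : pred 'I_n :=
  [pred l : 'I_n | (t.1 < l < t.2)%N].

(* [e] is the eye of [p].  The definition is meant for uniquely sorted [p],
   which have exactly one valid hook configuration. *)
Definition is_eye (R : realType) n (p : 'S_n) (e : nat) : Prop :=
  exists (H : seq ('I_n * 'I_n)) (t : 'I_n * 'I_n) (j : 'I_n),
    [/\ valid_hook_configuration R p H,
        is_top_hook p H t,
        j \in sheltered t,
        (forall l : 'I_n, l \in sheltered t -> (j <= l)%N)
      & entry p j = e].

(* Main.v *)
Require Import Defs.
From mathcomp Require Import all_boot all_order all_fingroup all_algebra.
From mathcomp Require Import boolp classical_sets set_interval reals.
From mathcomp Require Import ring zify.

(* A uniquely sorted word with more than one letter factors uniquely as A B m
   with m its largest letter, A and B uniquely sorted and last(A) > first(B);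
   its top hook joins the last letter of A to m, so its eye is first(B).  Let
   n(x,t) be the exponential generating function of the uniquely sorted words
   with first letter x and letters in [0,t], and T(t) that of all uniquely
   sorted words.  The pairs with first(A) = x give the Riccati equation
     dn/dt = T(t) n - int_x^t n(x,y) n(y,t) dy,   n(x,x) = 1,
   and the pairs with first(B) = x are counted by (T(t) - T(x)) n.  The
   equation forces (d/dx + d/dt) n = (T(t) - T(x)) n: the difference g of the
   two sides satisfies a linear equation in t and vanishes at t = x.  As
   d/dx + d/dt adds a letter below the first one, this is the equality of the
   two counts. *)

(** The Riccati equation has a minus sign because last(A) is the largest letter of A: a pair fails
    last(A) > first(B) exactly when all of A lies below y = first(B). Every letter above y is then
    in B, which is what cuts the integral at y. When first(B) = x, a failing A has only letters
    below x, whence T(x).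

    Series are written in x and u = t - x, so that the two indices of a coefficient count the
    letters below and above the first one. Then d/dt at fixed x is d/du, and d/dx + d/dt is d/dx at
    fixed u: both are index shifts.

    The factorization rests on one rigidity statement, [us_split_unique]: A B cannot be cut
    elsewhere into two words that satisfy a ballot condition on descents. Outputs of stack-sorting
    satisfy it, so do uniquely sorted words, and so do the two pieces, last letter deleted, on
    either side of the start of the hook that ends at the last letter. This yields the unique
    preimage, the unique split and the place of the top hook. *)

Set Implicit Arguments.
Unset Strict Implicit.
Unset Printing Implicit Defensive.

(** * Bivariate exponential generating functions *)

Section Egf.
Import GRing.Theory.
Local Open Scope ring_scope.

(* The pairs (#|I|, #|J|) for the ordered partitions (I, J) of an n-set. *)
Fixpoint splitn n : seq (nat * nat) :=
  if n is n'.+1 then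
    [seq (q.1.+1, q.2) | q <- splitn n'] ++ [seq (q.1, q.2.+1) | q <- splitn n']
  else [:: (0, 0)]%N.

(* [f i j] is the coefficient of x^i/i! u^j/j!, where u stands for t - x. *)
Definition egf := nat -> nat -> int.
Definition egf_dx (f : egf) : egf := fun i j => f i.+1 j.
Definition egf_du (f : egf) : egf := fun i j => f i j.+1.
Definition egf_add (f g : egf) : egf := fun i j => f i j + g i j.
Definition egf_sub (f g : egf) : egf := fun i j => f i j - g i j.
Definition egf_mul (f g : egf) : egf := fun i j =>
  \sum_(q <- splitn i) \sum_(r <- splitn j) f q.1 r.1 * g q.2 r.2.
(* f(x+u, 0) *)
Definition egf_shift (f : egf) : egf := fun i j => f (i + j)%N 0%N.
(* int_0^u f(x,v) g(x+v,u-v) dv *)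
Definition egf_int (f g : egf) : egf := fun i j =>
  \sum_(q <- splitn i) \sum_(p < j) \sum_(r <- splitn p)
    f q.1 r.1 * g (q.2 + r.2)%N (j - p.+1)%N.
(* T(x) and T(x+u) = T(t) *)
Definition egf_x (T : nat -> int) : egf := fun i j => if j is 0%N then T i else 0.
Definition egf_t (T : nat -> int) : egf := fun i j => T (i + j)%N.

Declare Scope egf_scope.
Delimit Scope egf_scope with G.
Bind Scope egf_scope with egf.
Local Notation "f + g" := (egf_add f g) : egf_scope.
Local Notation "f - g" := (egf_sub f g) : egf_scope.
Local Notation "f * g" := (egf_mul f g) : egf_scope.

Lemma egfP (f g : egf) : (forall i j, f i j = g i j) -> f = g.
Proof. by move=> e; apply/funext=> i; apply/funext=> j. Qed.

Lemma egf_addE (f g : egf) i j : (f + g)%G i j = f i j + g i j. Proof. by []. Qed.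
Lemma egf_subE (f g : egf) i j : (f - g)%G i j = f i j - g i j. Proof. by []. Qed.

Lemma egf_mulDl (f g h : egf) : ((f + g) * h = f * h + g * h)%G.
Proof.
apply: egfP => i j; rewrite egf_addE -big_split; apply: eq_bigr => q _.
by rewrite -big_split; apply: eq_bigr => r _; rewrite mulrDl.
Qed.

Lemma egf_mulBr (f g h : egf) : (f * (g - h) = f * g - f * h)%G.
Proof.
apply: egfP => i j; rewrite egf_subE -sumrB; apply: eq_bigr => q _.
by rewrite -sumrB; apply: eq_bigr => r _; rewrite mulrBr.
Qed.

Lemma egf_mulDr (f g h : egf) : (f * (g + h) = f * g + f * h)%G.
Proof.
apply: egfP => i j; rewrite egf_addE -big_split; apply: eq_bigr => q _.
by rewrite -big_split; apply: eq_bigr => r _; rewrite mulrDr.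
Qed.

Lemma egf_mul00 (f g : egf) : (f * g)%G 0%N 0%N = f 0%N 0%N * g 0%N 0%N.
Proof. by rewrite /egf_mul /= !big_seq1. Qed.

(** [splitn i.+1] lists the two ways of placing one more element, so the Leibniz rule is its
    unfolding. This is the benefit of listing ordered partitions over writing binomial
    coefficients. *)
Lemma egf_mul_dx (f g : egf) :
  egf_dx (f * g) = (egf_dx f * g + f * egf_dx g)%G.
Proof. by apply: egfP => i j; rewrite /egf_dx {1}/egf_mul /= big_cat !big_map. Qed.

Lemma egf_mul_du (f g : egf) :
  egf_du (f * g) = (egf_du f * g + f * egf_du g)%G.
Proof.
apply: egfP => i j; rewrite /egf_du {1}/egf_mul egf_addE -big_split /=.
by apply: eq_bigr => q _; rewrite big_cat !big_map.
Qed.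

(** A coefficient is the value at (0, 0) of an iterated derivative, and both sides obey the same
    Leibniz rule, so induction on the indices leaves only the constant terms. Associativity and
    [egf_shift_mul] follow the same pattern. *)
Lemma egf_mulC (f g : egf) : (f * g = g * f)%G.
Proof.
apply: egfP => i j; elim: i f g => [|i IHi] f g; last first.
  rewrite -[LHS]/(egf_dx (f * g) i j) -[RHS]/(egf_dx (g * f) i j).
  by rewrite !egf_mul_dx !egf_addE addrC; congr (_ + _); exact: IHi.
elim: j f g => [|j IHj] f g; first by rewrite !egf_mul00 mulrC.
rewrite -[LHS]/(egf_du (f * g) 0%N j) -[RHS]/(egf_du (g * f) 0%N j).
by rewrite !egf_mul_du !egf_addE addrC; congr (_ + _); exact: IHj.
Qed.

Lemma egf_mulA (f g h : egf) : (f * (g * h) = f * g * h)%G.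
Proof.
apply: egfP => i j; elim: i f g h => [|i IHi] f g h; last first.
  rewrite -[LHS]/(egf_dx (f * (g * h)) i j) -[RHS]/(egf_dx (f * g * h) i j).
  by rewrite !(egf_mul_dx, egf_mulDl, egf_mulDr, egf_addE) !IHi addrA.
elim: j f g h => [|j IHj] f g h; first by rewrite !egf_mul00 mulrA.
rewrite -[LHS]/(egf_du (f * (g * h)) 0%N j) -[RHS]/(egf_du (f * g * h) 0%N j).
by rewrite !(egf_mul_du, egf_mulDl, egf_mulDr, egf_addE) !IHj addrA.
Qed.

Lemma egf_mulCA (f g h : egf) : (f * (g * h) = g * (f * h))%G.
Proof. by rewrite !egf_mulA (egf_mulC f g). Qed.

Lemma egf_shift_dx f : egf_dx (egf_shift f) = egf_shift (egf_dx f).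
Proof. by []. Qed.

Lemma egf_shift_du f : egf_du (egf_shift f) = egf_shift (egf_dx f).
Proof. by apply: egfP => i j; rewrite /egf_du /egf_shift addnS. Qed.

Lemma egf_shift_mul (f g : egf) :
  egf_shift (f * g) = (egf_shift f * egf_shift g)%G.
Proof.
apply: egfP => i j; elim: i f g => [|i IHi] f g; last first.
  rewrite -[LHS]/(egf_dx (egf_shift (f * g)) i j).
  rewrite -[RHS]/(egf_dx (egf_shift f * egf_shift g) i j).
  by rewrite egf_mul_dx !egf_shift_dx egf_mul_dx !egf_addE -!IHi.
elim: j f g => [|j IHj] f g; first by rewrite [RHS]egf_mul00 /egf_shift addn0 egf_mul00.
rewrite -[LHS]/(egf_du (egf_shift (f * g)) 0%N j).
rewrite -[RHS]/(egf_du (egf_shift f * egf_shift g) 0%N j).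
by rewrite egf_mul_du !egf_shift_du egf_mul_dx !egf_addE -!IHj.
Qed.

Lemma egf_int0 (f g : egf) i : egf_int f g i 0%N = 0.
Proof. by rewrite /egf_int big1 // => q _; rewrite big_ord0. Qed.

Lemma egf_int_dx (f g : egf) :
  egf_dx (egf_int f g) = (egf_int (egf_dx f) g + egf_int f (egf_dx g))%G.
Proof. by apply: egfP => i j; rewrite /egf_dx {1}/egf_int /= big_cat !big_map. Qed.

(** Differentiation under the integral sign: the boundary term at v = u is f(x,u) g(x+u,0), hence
    the shift of [g]. *)
Lemma egf_int_du (f g : egf) :
  egf_du (egf_int f g) = (f * egf_shift g + egf_int f (egf_du g))%G.
Proof.
apply: egfP => i j; rewrite /egf_du {1}/egf_int egf_addE -big_split /=.
(* The new summand [p = j] takes [g] at u-degree 0: it is the boundary term. *)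
apply: eq_bigr => q _; rewrite big_ord_recr /= addrC subnn; congr (_ + _).
by apply: eq_bigr => p _; apply: eq_bigr => r _; rewrite subSS -subSn.
Qed.

Lemma egf_intDr (f g h : egf) :
  egf_int f (g + h)%G = (egf_int f g + egf_int f h)%G.
Proof.
apply: egfP => i j; rewrite egf_addE -big_split; apply: eq_bigr => q _.
rewrite -big_split; apply: eq_bigr => p _; rewrite -big_split.
by apply: eq_bigr => r _; rewrite mulrDr.
Qed.

Lemma egf_intBr (f g h : egf) :
  egf_int f (g - h)%G = (egf_int f g - egf_int f h)%G.
Proof.
apply: egfP => i j; rewrite egf_subE -sumrB; apply: eq_bigr => q _.
rewrite -sumrB; apply: eq_bigr => p _; rewrite -sumrB.
by apply: eq_bigr => r _; rewrite mulrBr.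
Qed.

Lemma egf_intBl (f g h : egf) :
  egf_int (f - g)%G h = (egf_int f h - egf_int g h)%G.
Proof.
apply: egfP => i j; rewrite egf_subE -sumrB; apply: eq_bigr => q _.
rewrite -sumrB; apply: eq_bigr => p _; rewrite -sumrB.
by apply: eq_bigr => r _; rewrite mulrBl.
Qed.

(** * Factors depending on x alone or on t alone *)

Lemma egf_x_mul_du T (f : egf) : egf_du (egf_x T * f) = (egf_x T * egf_du f)%G.
Proof.
rewrite egf_mul_du; apply: egfP => i j; rewrite egf_addE.
suff -> : (egf_du (egf_x T) * f)%G i j = 0 by rewrite add0r.
by rewrite /egf_mul big1 // => q _; rewrite big1 // => r _; rewrite mul0r.
Qed.

Lemma egf_t_du T : egf_du (egf_t T) = egf_t (T \o succn).
Proof. by apply: egfP => i j; rewrite /egf_du /egf_t addnS. Qed.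

Lemma egf_shift_x T : egf_shift (egf_x T) = egf_t T. Proof. by []. Qed.
Lemma egf_shift_t T : egf_shift (egf_t T) = egf_t T.
Proof. by apply: egfP => i j; rewrite /egf_shift /egf_t addn0. Qed.

Lemma splitn_leq n q : q \in splitn n -> (q.1 <= n)%N /\ (q.2 <= n)%N.
Proof.
elim: n q => [|n IHn] q /=; first by rewrite inE => /eqP ->.
rewrite mem_cat => /orP[] /mapP[r /IHn[le1 le2] ->] /=; split=> //;
  exact: leqW.
Qed.

(** Products and integrals are triangular in the u-degree. This lets the induction of [riccati_dx]
    substitute its hypothesis under both. *)
Lemma egf_mul_eqr (f g g' : egf) i j :
  (forall a b, (b <= j)%N -> g a b = g' a b) -> (f * g)%G i j = (f * g')%G i j.
Proof.
move=> e; apply: eq_bigr => q _; rewrite !big_seq; apply: eq_bigr => r.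
by move=> /splitn_leq[_ ?]; rewrite e.
Qed.

Lemma egf_int_eql (f f' g : egf) i j :
  (forall a b, (b <= j)%N -> f a b = f' a b) -> egf_int f g i j = egf_int f' g i j.
Proof.
move=> e; apply: eq_bigr => q _; apply: eq_bigr => p _; rewrite !big_seq.
apply: eq_bigr => r /splitn_leq[rp _]; rewrite e //.
by rewrite (leq_trans rp) // ltnW.
Qed.

Lemma egf_int_eqr (f g g' : egf) i j :
  (forall a b, (b <= j)%N -> g a b = g' a b) -> egf_int f g i j = egf_int f g' i j.
Proof.
move=> e; apply: eq_bigr => q _; apply: eq_bigr => p _.
by apply: eq_bigr => r _; rewrite e // leq_subr.
Qed.

(** T(x) is constant in the integration variable v. Formally, both sides vanish at u = 0 and have
    matching u-derivatives. *)
Lemma egf_int_xl T (f g : egf) :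
  egf_int (egf_x T * f)%G g = (egf_x T * egf_int f g)%G.
Proof.
apply: egfP => i j; elim: j i f g => [|j IHj] i f g.
  rewrite egf_int0 /egf_mul big1 // => q _.
  by rewrite /= big_seq1 egf_int0 mulr0.
rewrite -[LHS]/(egf_du (egf_int (egf_x T * f) g) i j).
rewrite -[RHS]/(egf_du (egf_x T * egf_int f g) i j).
by rewrite egf_x_mul_du !egf_int_du egf_mulDr !egf_addE IHj egf_mulA.
Qed.

(** For the left factor f(x,v), t stands for x+v, which is the base point of the right factor
    g(x+v,u-v); so T moves across. *)
Lemma egf_int_tl T (f g : egf) :
  egf_int (egf_t T * f)%G g = egf_int f (egf_x T * g)%G.
Proof.
apply: egfP => i j; elim: j i f g => [|j IHj] i f g; first by rewrite !egf_int0.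
rewrite -[LHS]/(egf_du (egf_int (egf_t T * f) g) i j).
rewrite -[RHS]/(egf_du (egf_int f (egf_x T * g)) i j).
rewrite !egf_int_du egf_x_mul_du !egf_addE IHj egf_shift_mul egf_shift_x.
by rewrite egf_mulCA egf_mulA.
Qed.

(** For the right factor, t stands for (x+v) + (u-v) = x+u, whatever v is. [T] is generalized in the
    induction because [egf_t_du] shifts it. *)
Lemma egf_int_tr T (f g : egf) :
  egf_int f (egf_t T * g)%G = (egf_t T * egf_int f g)%G.
Proof.
apply: egfP => i j; elim: j i T f g => [|j IHj] i T f g.
  rewrite egf_int0 /egf_mul big1 // => q _.
  by rewrite /= big_seq1 egf_int0 mulr0.
rewrite -[LHS]/(egf_du (egf_int f (egf_t T * g)) i j).
rewrite -[RHS]/(egf_du (egf_t T * egf_int f g) i j).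
rewrite egf_mul_du !egf_int_du egf_shift_mul egf_shift_t egf_mul_du egf_t_du.
rewrite egf_mulDr egf_intDr !egf_addE !IHj (egf_mulCA f).
by rewrite addrCA.
Qed.

(** The linear equation for the difference of the two sides appears coefficientwise, as a strong
    induction on the u-degree, for all x-degrees at once. *)
Lemma riccati_dx (T : nat -> int) (n : egf) :
    (forall i, n i 0%N = (i == 0%N)%:R) ->
    egf_du n = (egf_t T * n - egf_int n n)%G ->
  egf_dx n = (egf_t T * n - egf_x T * n)%G.
Proof.
move=> n0 ndu; apply: egfP => i j.
elim: {j}j.+1 {-2}j (leqnn j.+1) i => // m IHm [|j] ltjm i.
  (* At u = 0 the series is the constant 1, with derivative 0, and T(t) = T(x). *)
  rewrite /egf_dx n0 egf_subE /egf_mul [X in _ - X](_ : _ =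
    \sum_(q <- splitn i) \sum_(r <- splitn 0) egf_t T q.1 r.1 * n q.2 r.2) ?subrr //.
  by apply: eq_bigr => q _; rewrite /= !big_seq1 /egf_t addn0.
have {IHm}dxE a b : (b <= j)%N ->
    egf_dx n a b = (egf_t T * n - egf_x T * n)%G a b.
  by move=> le_bj; apply: IHm; lia.
(* The derivations commute, so the left side is the x-derivative of the Riccati equation. *)
rewrite -[LHS]/(egf_dx (egf_du n) i j) -[RHS]/(egf_du (egf_t T * n - egf_x T * n) i j).
have -> f g : egf_du (f - g) = (egf_du f - egf_du g)%G by [].
rewrite egf_mul_du egf_x_mul_du egf_t_du ndu.
have -> f g : egf_dx (f - g) = (egf_dx f - egf_dx g)%G by [].
rewrite egf_mul_dx egf_int_dx -[egf_dx (egf_t T)]/(egf_t (T \o succn)).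
rewrite !(egf_subE, egf_addE) (egf_mul_eqr _ _ dxE).
rewrite (egf_int_eql _ _ dxE) (egf_int_eqr _ _ dxE).
(* After substitution, int(n, T(x) n) occurs twice with opposite signs, once from T(t) in the left
   factor; the integrals sum to (T(t) - T(x)) int(n, n). *)
rewrite !(egf_mulBr, egf_intBr, egf_intBl, egf_subE, egf_addE).
rewrite egf_int_xl egf_int_tl egf_int_tr (egf_mulCA (egf_x T)).
ring.
Qed.

End Egf.

(** * Stack-sorting and uniquely sorted words *)

Lemma max_split (s : seq nat) : s != [::] -> uniq s ->
  exists L m R, s = L ++ m :: R /\ all (fun x => x < m)%N (L ++ R).
Proof.
move=> s0 us; pose m := \max_(x <- s) x.
have ms : m \in s.
  rewrite /m; elim: s s0 {us m} => // x [|y s] IHs _; first by rewrite big_seq1 inE.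
  rewrite big_cons inE /maxn; case: ltnP => _; last by rewrite eqxx.
  by rewrite IHs // orbT.
have lem x : x \in s -> (x <= m)%N by move=> xs; apply: leq_bigmax_seq.
case/splitPr: ms us lem => L R; rewrite uniq_catC cons_uniq => /andP[mR _] lem.
exists L, m, R; split=> //; apply/allP => x xLR.
rewrite ltn_neqAle lem ?andbT; last first.
  by move: xLR; rewrite !mem_cat inE => /orP[] ->; rewrite ?orbT.
by apply: contraNneq mR => <-; rewrite mem_cat orbC -mem_cat.
Qed.

(** A block whose letters are below both the next input letter and the top of the stack is sorted as
    if it were alone. The default [x.+1] makes each bound vacuous when the input or the stack is
    empty. Both conclusions come from the same computation [key]. *)
Lemma iter_stack_step_cat (L rest stk out : seq nat) : uniq L ->
    all (fun x => x < head x.+1 rest)%N L -> all (fun x => x < head x.+1 stk)%N L ->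
  iter (2 * size L) stack_step (L ++ rest, stk, out)
    = (rest, stk, out ++ stack_sort L) /\
  (forall L1 m L2, L = L1 ++ m :: L2 -> all (fun x => x < m)%N (L1 ++ L2) ->
     stack_sort L = stack_sort L1 ++ rcons (stack_sort L2) m).
Proof.
move: {2}(size L) (leqnn (size L)) => n.
elim: n L rest stk out => [|n IHn] L rest stk out.
  by case: L => // _ _ _ _; split=> [|[]//]; rewrite cats0.
case: (eqVneq L [::]) => [-> _ _ _ _|L0]; first by split=> [|[]//]; rewrite cats0.
move=> ltLn uL Lrest Lstk; rewrite /stack_sort.
have key L1 m L2 rest' stk' out' : L = L1 ++ m :: L2 ->
    all (fun x => x < m)%N (L1 ++ L2) ->
    all (fun x => x < head x.+1 rest')%N L -> all (fun x => x < head x.+1 stk')%N L ->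
    iter (2 * size L) stack_step (L ++ rest', stk', out')
      = (rest', stk', out' ++ stack_sort L1 ++ rcons (stack_sort L2) m).
  move=> eL; rewrite all_cat => /andP[ltL1 ltL2].
  move: ltLn uL; rewrite eL size_cat /= cat_uniq cons_uniq.
  move=> ltLn /and3P[uL1 _ /andP[_ uL2]]; rewrite !all_cat /=.
  move=> /and3P[Lr1 Lrm Lr2] /and3P[Ls1 Lsm Ls2].
  (* [iterD] runs the rightmost summand first: sort [L1], push [m], sort [L2] on top of it, pop
     [m]. *)
  have -> : (2 * (size L1 + (size L2).+1) = 1 + (2 * size L2 + (1 + 2 * size L1)))%N.
    by clear; lia.
  have [le1 le2] : (size L1 <= n)%N /\ (size L2 <= n)%N by move: ltLn; clear; lia.
  rewrite (iterD 1) (iterD (2 * size L2)) (iterD 1) -catA (proj1 (IHn L1 _ _ _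
    le1 _ _ _)) //.
  have -> o : iter 1 stack_step ((m :: L2) ++ rest', stk', o) =
    (L2 ++ rest', m :: stk', o).
    by case: (stk') Lsm => //= y stk'' ->.
  rewrite (proj1 (IHn L2 _ _ _ le2 _ _ _)) //.
  rewrite -cats1 !catA cats1; case: (rest') Lrm => //= y rest'' ltmy.
  by rewrite ltnNge ltnW.
have [L1 [m [L2 [eL ltL]]]] := max_split L0 uL.
have sortE L1' m' L2' : L = L1' ++ m' :: L2' -> all (fun x => x < m')%N (L1' ++ L2') ->
    (iter (2 * size L) stack_step (L, [::], [::])).2 =
      stack_sort L1' ++ rcons (stack_sort L2') m'.
  by move=> /key /[apply] /(_ [::] [::] [::]); rewrite cats0 => -> //; apply/allP => x /=.
split; last exact: sortE.
by rewrite (key _ _ _ _ _ _ eL) // (sortE _ _ _ eL).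
Qed.

Lemma stack_sort_max (L : seq nat) m R : uniq (L ++ m :: R) ->
    all (fun x => x < m)%N (L ++ R) ->
  stack_sort (L ++ m :: R) = stack_sort L ++ rcons (stack_sort R) m.
Proof.
move=> u; apply: (proj2 (@iter_stack_step_cat _ [::] [::] [::] u _ _)) => //;
by apply/allP => x /=.
Qed.

Lemma stack_sort_perm (s : seq nat) : uniq s -> perm_eq (stack_sort s) s.
Proof.
move: {2}(size s) (leqnn (size s)) => n; elim: n s => [|n IHn] s; first by case: s.
case: (eqVneq s [::]) => [-> //|s0 ltsn us].
have [L [m [R [es ltm]]]] := max_split s0 us.
move: ltsn us; rewrite es size_cat /= => ltsn us.
rewrite stack_sort_max //; have:= us; rewrite cat_uniq cons_uniq.
case/and3P=> uL _ /andP[_ uR].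
apply: perm_cat; first by apply: IHn => //; lia.
by rewrite perm_rcons perm_cons; apply: IHn => //; lia.
Qed.

(* The words with exactly one preimage under stack-sorting. *)
Inductive us_word : seq nat -> Prop :=
| us_word1 x : us_word [:: x]
| us_word_split A B m : us_word A -> us_word B -> (head 0 B < last 0 A)%N ->
    all (fun x => x < m)%N (A ++ B) -> us_word (A ++ rcons B m).

Lemma us_word_neq0 w : us_word w -> w != [::].
Proof. by case=> // A B m _ _ _ _; rewrite -size_eq0 size_cat size_rcons addnS. Qed.

Lemma us_word_last w : us_word w -> all (fun x => x <= last 0 w)%N w.
Proof.
case=> [x|A B m _ _ _]; first by rewrite /= leqnn.
move=> ltm; rewrite last_cat last_rcons -rcons_cat all_rcons leqnn /=.
by apply: sub_all ltm => x /ltnW.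
Qed.

(** * Descent patterns as lattice paths *)

Definition steps (w : seq nat) : seq bool :=
  pairmap (fun x y => y < x)%N (head 0 w) (behead w).

Lemma steps_cat u v : u != [::] -> v != [::] ->
  steps (u ++ v) = steps u ++ (head 0 v < last 0 u)%N :: steps v.
Proof. by case: u => // x u; case: v => // y v _ _; rewrite /steps /= pairmap_cat. Qed.

Lemma size_steps w : size (steps w) = (size w).-1.
Proof. by rewrite size_pairmap size_behead. Qed.

Lemma steps_rcons w m : w != [::] -> all (fun x => x < m)%N w ->
  steps (rcons w m) = rcons (steps w) false.
Proof.
move=> w0 /allP wm; rewrite -cats1 steps_cat // /= -cats1.
suff -> : (m < last 0 w)%N = false by [].
by apply/negbTE; rewrite -leqNgt ltnW // wm //; case: w w0 {wm} => // x s _;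
  apply: mem_last.
Qed.

Local Notation ndes := (count id).
Local Notation nasc := (count negb).

(** Outputs of stack-sorting satisfy this condition. Uniquely sorted words satisfy [prefix_ballot]
    as well, with equal totals. *)
Definition suffix_ballot (t : seq bool) :=
  forall i, (ndes (drop i t) <= nasc (drop i t))%N.
Definition prefix_ballot (t : seq bool) :=
  forall i, (nasc (take i t) <= ndes (take i t))%N.

Lemma suffix_ballot_cat t1 t2 : suffix_ballot t1 -> suffix_ballot t2 ->
  suffix_ballot (t1 ++ t2).
Proof.
move=> b1 b2 i; rewrite drop_cat; case: ltnP => _; last exact: b2.
by rewrite !count_cat; apply: leq_add => //; rewrite -(drop0 t2); apply: b2.
Qed.

Lemma suffix_ballot_lift t b : suffix_ballot t -> suffix_ballot (b :: rcons t false).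
Proof.
move=> bt [|i]; rewrite ?drop0 /=; last first.
  rewrite -cats1 drop_cat; case: ltnP => _; last first.
    by case: (i - size t)%N => [|[]].
  by have := bt i; rewrite !count_cat /=; lia.
by have := bt 0%N; rewrite drop0 -cats1 !count_cat /=; case: b => /=; lia.
Qed.

Lemma prefix_ballot_cat t1 t2 : prefix_ballot t1 -> prefix_ballot t2 ->
  prefix_ballot (t1 ++ t2).
Proof.
move=> b1 b2 i; rewrite take_cat; case: ltnP => _; first exact: b1.
by rewrite !count_cat; apply: leq_add => //; rewrite -(take_size t1); apply: b1.
Qed.

Lemma prefix_ballot_lift t : prefix_ballot t -> prefix_ballot (true :: rcons t false).
Proof.
move=> bt [|i] //=; rewrite -cats1 take_cat; case: ltnP => _.
  by rewrite (leq_trans (bt i)) // leq_addl.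
have:= bt (size t); rewrite take_size !count_cat.
by case: (i - size t)%N => [|[|?]] /=; lia.
Qed.

Lemma steps_join A B m : A != [::] -> B != [::] -> all (fun x => x < m)%N B ->
  steps (A ++ rcons B m)
    = steps A ++ (head 0 B < last 0 A)%N :: rcons (steps B) false.
Proof.
move=> A0 B0 ltB; rewrite steps_cat ?steps_rcons //; first by case: (B) B0.
by rewrite -size_eq0 size_rcons.
Qed.

(** The pattern of A B m is that of A, then that of B enclosed between the junction descent and the
    ascent to m: the last-return decomposition of a Dyck path. *)
Lemma us_word_steps w : us_word w -> prefix_ballot (steps w) /\ ndes (steps w) =
  nasc (steps w).
Proof.
elim=> [x|A B m uA [pA eA] uB [pB eB] des ltm]; first by split=> [[]|].
have A0 := us_word_neq0 uA; have B0 := us_word_neq0 uB.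
have ltB : all (fun x => x < m)%N B by move: ltm; rewrite all_cat => /andP[].
rewrite steps_join // des; split; last by rewrite -cats1 !count_cat /= !count_cat /=; lia.
by apply: prefix_ballot_cat => //; apply: prefix_ballot_lift.
Qed.

(** In s(L) s(R) m, the only descent that the junction can add is paid for by the final ascent to
    m. *)
Lemma stack_sort_ballot (s : seq nat) : uniq s -> suffix_ballot (steps (stack_sort s)).
Proof.
move: {2}(size s) (leqnn (size s)) => n; elim: n s => [|n IHn] s; first by case: s.
case: (eqVneq s [::]) => [-> //|s0 ltsn us].
have [L [m [R [es ltm]]]] := max_split s0 us.
move: ltsn us; rewrite es size_cat /= => ltsn us.
rewrite stack_sort_max //; have:= us; rewrite cat_uniq cons_uniq.
case/and3P=> uL _ /andP[_ uR]; move: ltm; rewrite all_cat => /andP[ltL ltR].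
have {ltL}ltL : all (fun x => x < m)%N (stack_sort L).
  by rewrite (perm_all _ (stack_sort_perm uL)).
have {ltR}ltR : all (fun x => x < m)%N (stack_sort R).
  by rewrite (perm_all _ (stack_sort_perm uR)).
have bL : suffix_ballot (steps (stack_sort L)) by apply: IHn => //; lia.
have {IHn}bR : suffix_ballot (steps (stack_sort R)) by apply: IHn => //; lia.
have bm u : all (fun x => x < m)%N u -> suffix_ballot (steps u) ->
    suffix_ballot (steps (rcons u m)).
  case: (eqVneq u [::]) => [-> _ _ []//|u0 ltu bu].
  rewrite steps_rcons // -cats1; apply: suffix_ballot_cat => //.
  by case=> [|[]].
case: (eqVneq (stack_sort R) [::]) => [->|R0]; first by rewrite cats1; exact: bm.
case: (eqVneq (stack_sort L) [::]) => [->|L0]; first exact: bm.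
by rewrite steps_join //; apply: suffix_ballot_cat => //; apply: suffix_ballot_lift.
Qed.

Lemma cat_eq_longer (A B C D : seq nat) : (size A < size C)%N -> A ++ B = C ++ D ->
  exists E, [/\ E != [::], C = A ++ E & B = E ++ D].
Proof.
move=> ltAC eAB; exists (drop (size A) C).
have eC : take (size A) C = A.
  by rewrite -[RHS](take_size_cat B (erefl (size A))) eAB take_cat ltAC.
split; first by rewrite -size_eq0 size_drop subn_eq0 -ltnNge.
  by rewrite -{1}(cat_take_drop (size A) C) eC.
by rewrite -(drop_size_cat B (erefl (size A))) eAB drop_cat ltAC.
Qed.

(* The steps of a uniquely sorted word form a Dyck path (descents going up), so
   its last prime component, hence the split, is determined. *)
Lemma us_split_unique A B C D : us_word A -> us_word B -> (head 0 B < last 0 A)%N ->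
    A ++ B = C ++ D -> suffix_ballot (steps C) -> suffix_ballot (steps D) ->
  A = C /\ B = D.
Proof.
move=> uA uB des eAB bC bD.
have A0 := us_word_neq0 uA; have B0 := us_word_neq0 uB.
have [_ eqA] := us_word_steps uA; have [pB eqB] := us_word_steps uB.
have [ltCA|ltAC|eAC] := ltngtP (size C) (size A); last first.
- by move/eqP: eAB; rewrite eqseq_cat // => /andP[/eqP-> /eqP->].
(* Here C = A E: A is balanced, then comes the descent, and E, a prefix of B, has no excess of
   ascents. So C has too many descents. *)
- have [E [E0 eC eB]] := cat_eq_longer ltAC eAB.
  have := bC 0; rewrite drop0 eC steps_cat //.
  have -> : head 0 E = head 0 B by rewrite eB; case: (E) E0.
  rewrite des !count_cat /=.
  have : (nasc (steps E) <= ndes (steps E))%N.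
    case: (eqVneq D [::]) => [eD|D0]; first by rewrite eD cats0 in eB; rewrite -eB eqB.
    by have := pB (size (steps E)); rewrite eB steps_cat // take_size_cat.
  lia.
(* Here D = E B: the suffix of steps from the descent between E and the balanced B has one descent
   too many. *)
- have [E [E0 eA eD]] := cat_eq_longer ltCA (esym eAB).
  have := bD (size (steps E)); rewrite eD steps_cat // drop_size_cat //.
  have -> : last 0 E = last 0 A by rewrite eA last_cat; case: (E) E0.
  by rewrite des /= eqB; lia.
Qed.

Lemma stack_sort_eq0 (s : seq nat) : uniq s -> (stack_sort s == [::]) = (s == [::]).
Proof. by move=> us; rewrite -!size_eq0 (perm_size (stack_sort_perm us)). Qed.

Lemma stack_sort_last (s : seq nat) : uniq s ->
  all (fun x => x <= last 0 (stack_sort s))%N (stack_sort s).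
Proof.
case: (eqVneq s [::]) => [-> //|s0 us]; have [L [m [R [es ltm]]]] := max_split s0 us.
move: us; rewrite es => us; rewrite stack_sort_max // last_cat last_rcons.
have /perm_all <- : perm_eq (L ++ m :: R) (stack_sort L ++ rcons (stack_sort R) m).
  by rewrite -stack_sort_max // perm_sym stack_sort_perm.
move: ltm; rewrite !all_cat /= leqnn => /andP[ltL ltR].
by apply/andP; split; [apply: sub_all ltL|apply: sub_all ltR] => x /ltnW.
Qed.

Lemma stack_sort_join (a b : seq nat) m : uniq a -> uniq b ->
    uniq (stack_sort a ++ rcons (stack_sort b) m) ->
    all (fun x => x < m)%N (stack_sort a ++ stack_sort b) ->
  uniq (a ++ m :: b) /\
  stack_sort (a ++ m :: b) = stack_sort a ++ rcons (stack_sort b) m.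
Proof.
move=> ua ub u ltm; have pa := stack_sort_perm ua; have pb := stack_sort_perm ub.
have uab : uniq (a ++ m :: b).
  rewrite -(perm_uniq (_ : perm_eq (stack_sort a ++ rcons (stack_sort b) m) _)) //.
  by rewrite perm_cat // perm_rcons perm_cons.
split=> //; apply: stack_sort_max => //.
by rewrite -(perm_all _ (perm_cat pa pb)).
Qed.

Lemma head_cat_rcons (s t : seq nat) m : head 0 (s ++ rcons t m) \in rcons (s ++ t) m.
Proof. by case: s t => [|x s] [|y t]; rewrite /= inE eqxx. Qed.

(** An ascent at the junction lets two inputs merge: with b = L m R, merge a into L, or into R when
    L is empty. This supplies a second preimage in [unique_preimage_us]. *)
Lemma stack_sort_ascent (a b : seq nat) : uniq a -> uniq b -> a != [::] -> b != [::] ->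
    uniq (stack_sort a ++ stack_sort b) ->
    (last 0 (stack_sort a) < head 0 (stack_sort b))%N ->
  exists2 v, uniq v & stack_sort v = stack_sort a ++ stack_sort b.
Proof.
move: {2}(size b) (leqnn (size b)) => n; elim: n b => [|n IHn] b; first by case: b.
move=> ltbn ua ub a0 b0; have [L [m [R [eb ltm]]]] := max_split b0 ub.
move: ltbn ub; rewrite {b0}eb size_cat /= => ltbn ub.
have:= ub; rewrite cat_uniq cons_uniq => /and3P[uL _ /andP[_ uR]].
have [leL leR] : (size L <= n)%N /\ (size R <= n)%N by move: ltbn; clear; lia.
rewrite (stack_sort_max ub) // => u ltah.
have pLR := perm_cat (stack_sort_perm uL) (stack_sort_perm uR).
rewrite -(perm_all _ pLR) in ltm.
(* last(s(a)) is the largest letter of a and lies below the first letter of s(b), so m still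
   dominates. *)
have ltm' : all (fun x => x < m)%N (stack_sort a ++ stack_sort L ++ stack_sort R).
  rewrite all_cat ltm andbT; apply: sub_all (stack_sort_last ua) => x le_x.
  rewrite (leq_ltn_trans le_x) // (leq_trans ltah) //.
  have := head_cat_rcons (stack_sort L) (stack_sort R) m.
  by rewrite mem_rcons inE => /predU1P[->//|/(allP ltm)/ltnW].
case: (eqVneq L [::]) => [L0|L0]; last first.
  have [||v uv sv] := IHn L leL ua uL a0 L0.
  - by move: u; rewrite catA cat_uniq => /andP[].
  - by move: L0 ltah; rewrite -stack_sort_eq0 //; case: (stack_sort L).
  have [||uvR svR] := @stack_sort_join v R m uv uR; rewrite ?sv -?catA //.
  by exists (v ++ m :: R); rewrite // svR sv catA.
rewrite L0 /= in u ltah ltm' *.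
case: (eqVneq R [::]) => [R0|R0].
  rewrite R0 in u ltm' *; have [||ua' sa'] := @stack_sort_join a [::] m ua isT => //.
  by exists (a ++ [:: m]).
have [||v uv sv] := IHn R leR ua uR a0 R0.
- by move: u; rewrite -rcons_cat rcons_uniq => /andP[].
- by move: R0 ltah; rewrite -stack_sort_eq0 //; case: (stack_sort R).
have [||uv' sv'] := @stack_sort_join v [::] m uv isT;
  rewrite ?cats0 ?sv ?cats1 ?rcons_cat //.
by exists (v ++ [:: m]); rewrite // sv' sv cats1 rcons_cat.
Qed.

(** The preimage of A B m is a m b, with a and b the preimages of A and B. Any preimage L m R cuts A
    B into s(L) and s(R), both ballot, so [us_split_unique] identifies them with A and B. *)
Lemma us_word_preimage w : us_word w -> uniq w ->
  exists v, [/\ uniq v, stack_sort v = w &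
    forall v', uniq v' -> stack_sort v' = w -> v' = v].
Proof.
elim=> [x _|A B m uA IHA uB IHB des ltm u].
  exists [:: x]; split=> // v uv sv; have := stack_sort_perm uv.
  by rewrite sv perm_sym => /perm_small_eq ->.
have:= u; rewrite cat_uniq rcons_uniq =>
  /and3P[/IHA[a [ua sa aP]] _ /andP[_ /IHB[b [ub sb bP]]]].
rewrite -sa -sb in u ltm *; have [uv sv] := stack_sort_join ua ub u ltm.
exists (a ++ m :: b); split=> // v {}uv {}sv; have pv := stack_sort_perm uv.
have v0 : v != [::] by rewrite -stack_sort_eq0 // sv -size_eq0 size_cat size_rcons addnS.
have [L [M [R [ev ltM]]]] := max_split v0 uv.
move: uv sv; rewrite {}ev => uv; rewrite stack_sort_max // -!rcons_cat.
have:= uv; rewrite cat_uniq cons_uniq => /and3P[uL _ /andP[_ uR]].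
move=> /rcons_inj[eLR eM]; rewrite sa sb in eLR *.
have [eA eB] := us_split_unique uA uB des (esym eLR) (stack_sort_ballot uL)
  (stack_sort_ballot uR).
by rewrite eM (aP L) // (bP R).
Qed.

(** Write v = L m R. A second preimage of s(L) or s(R) could be substituted in v; an ascent at the
    junction, or exactly one empty side, would let m stand first or last over a common remainder. *)
Lemma unique_preimage_us v : uniq v -> v != [::] ->
    (forall v', uniq v' -> stack_sort v' = stack_sort v -> v' = v) ->
  us_word (stack_sort v).
Proof.
move: {2}(size v) (leqnn (size v)) => n; elim: n v => [|n IHn] v; first by case: v.
move=> ltvn uv v0; have [L [m [R [ev ltm]]]] := max_split v0 uv.
move: ltvn uv; rewrite {v0}ev size_cat /= => ltvn uv.
have:= uv; rewrite cat_uniq cons_uniq => /and3P[uL _ /andP[_ uR]].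
have [leL leR] : (size L <= n)%N /\ (size R <= n)%N by move: ltvn; clear; lia.
have pv := stack_sort_perm uv; rewrite (stack_sort_max uv) // in pv *.
have pLR := perm_cat (stack_sort_perm uL) (stack_sort_perm uR).
have {}ltm : all (fun x => x < m)%N (stack_sort L ++ stack_sort R)
  by rewrite (perm_all _ pLR).
have u : uniq (stack_sort L ++ rcons (stack_sort R) m) by rewrite (perm_uniq pv).
(* [m :: s] and [rcons s m] have the same output, and they differ when [s] is nonempty since [m] is
   not in [s]. *)
have mv (s : seq nat) : uniq s -> stack_sort s = stack_sort L ++ stack_sort R ->
    [/\ uniq (m :: s), uniq (rcons s m),
        stack_sort (m :: s) = stack_sort L ++ rcons (stack_sort R) m &
        stack_sort (rcons s m) = stack_sort L ++ rcons (stack_sort R) m].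
  move=> us es; have u1 : uniq (stack_sort [::] ++ rcons (stack_sort s) m)
    by rewrite es rcons_cat.
  have u2 : uniq (stack_sort s ++ rcons (stack_sort [::]) m)
    by rewrite cats1 es rcons_cat.
  have [] := @stack_sort_join [::] s m isT us u1; first by rewrite /= es.
  have [] := @stack_sort_join s [::] m us isT u2; first by rewrite cats0 es.
  by rewrite /= !cats1 es !rcons_cat.
have notin_m (s t : seq nat) : uniq (s ++ m :: t) -> m \notin s.
  by rewrite uniq_catC cons_uniq mem_cat => /andP[/norP[]].
move=> vP; case: (eqVneq L [::]) => [L0|L0].
  case: (eqVneq R [::]) => [R0|R0]; first by rewrite L0 R0; constructor.
  have [||u1 u2 e1 e2] := mv R; rewrite ?L0 //.
  have /esym := vP _ u2 e2; rewrite L0 /= -cats1; case: (R) R0 uv => //= y R' _.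
  by rewrite L0 /= inE => /andP[/norP[/eqP ny _] _] [].
case: (eqVneq R [::]) => [R0|R0].
  have [||u1 u2 e1 e2] := mv L; rewrite ?R0 ?cats0 //.
  have /esym := vP _ u1 e1; rewrite R0; case: (L) L0 uv => //= y L' _.
  by rewrite mem_cat inE => /andP[/norP[_ /norP[/eqP ny _]] _] [].
have LP (s : seq nat) : uniq s -> stack_sort s = stack_sort L -> s = L.
  move=> us es; have [||us' es'] := @stack_sort_join s R m us uR; rewrite ?es //.
  have := vP _ us'; rewrite es' es => /(_ erefl) /eqP.
  rewrite eqseq_cat; first by case/andP=> /eqP.
  by rewrite -(perm_size (stack_sort_perm us)) es (perm_size (stack_sort_perm uL)).
have RP (s : seq nat) : uniq s -> stack_sort s = stack_sort R -> s = R.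
  move=> us es; have [||us' es'] := @stack_sort_join L s m uL us; rewrite ?es //.
  have := vP _ us'; rewrite es' es => /(_ erefl) /eqP.
  by rewrite eqseq_cat // => /andP[_ /eqP[]].
have uLR : uniq (stack_sort L ++ stack_sort R).
  by move: u; rewrite -rcons_cat rcons_uniq => /andP[].
apply: us_word_split => //; [exact: IHn|exact: IHn|].
rewrite ltnNge; apply/negP => le_LR.
have [|s us es] := stack_sort_ascent uL uR L0 R0 uLR.
  rewrite ltn_neqAle le_LR andbT; apply/eqP => eLR.
  have lL : last 0 (stack_sort L) \in stack_sort L.
    by move: L0; rewrite -stack_sort_eq0 //; case: (stack_sort L) => //= *;
      apply: mem_last.
  have: head 0 (stack_sort R) \in stack_sort R.
    by move: R0; rewrite -stack_sort_eq0 //; case: (stack_sort R) => //= *;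
      apply: mem_head.
  rewrite -eLR => lR; move: uLR; rewrite cat_uniq => /and3P[_ /hasP[]].
  by exists (last 0 (stack_sort L)).
have [u1 u2 e1 e2] := mv s us es.
have := vP _ u2 e2; rewrite -(vP _ u1 e1) => /esym.
have: s != [::] by rewrite -stack_sort_eq0 // es; move: L0;
  rewrite -stack_sort_eq0 //; case: (stack_sort L).
case: (s) u1 => //= y s' /andP[/norP[/eqP ny _] _] _ [].
by [].
Qed.

(** * Hooks *)

Lemma steps_cons x y s : steps (x :: y :: s) = (y < x)%N :: steps (y :: s).
Proof. by []. Qed.

Lemma nth_steps w i : (i.+1 < size w)%N ->
  nth false (steps w) i = (nth 0 w i.+1 < nth 0 w i)%N.
Proof.
elim: w i => [//|x [|y s] IHs] [|i] //= lti.
by rewrite -[RHS](IHs i).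
Qed.

Lemma steps_take w i : steps (take i.+1 w) = take i (steps w).
Proof. by elim: w i => [|x [|y s] IHs] [|i] //; rewrite steps_cons /= -IHs. Qed.

Lemma steps_drop w i : steps (drop i w) = drop i (steps w).
Proof.
elim: w i => [|x [|y s] IHs] [|i] //.
by rewrite steps_cons /= -IHs.
Qed.

Definition descent_at (w : seq nat) i :=
  (i.+1 < size w)%N && (nth 0 w i.+1 < nth 0 w i)%N.

(* A valid hook configuration is encoded by the map [g] sending the southwest
   endpoint of each hook to its northeast endpoint. *)
Definition hook_map (w : seq nat) (g : nat -> nat) := forall i, descent_at w i ->
  [/\ (i < g i < size w)%N, (nth 0 w i < nth 0 w (g i))%N,
      (forall l, (i < l < g i)%N -> (nth 0 w l < nth 0 w (g i))%N)
    & forall i', descent_at w i' -> (i < i')%N -> (g i <= i')%N \/ (g i' < g i)%N].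

(** Send each descent [i] of the window to the step [(g i).-1] entering the northeast endpoint of
    its hook. That step is an ascent because nothing lies above the hook, and noncrossing hooks have
    distinct northeast endpoints. *)
Lemma hook_map_ballot w g a c : hook_map w g -> (c < size w)%N ->
    (forall i, (a <= i < c)%N -> descent_at w i -> (g i <= c)%N) ->
  (ndes (drop a (take c (steps w))) <= nasc (drop a (take c (steps w))))%N.
Proof.
move=> gw ltc gc; set t := take c (steps w).
have st : size t = c by rewrite size_takel // size_steps; lia.
have [le_ca|lt_ac] := leqP c a; first by rewrite drop_oversize // st.
have countE (P : pred bool) : count P (drop a t) =
  size [seq i <- iota a (c - a) | P (nth false t i)].
  rewrite size_filter -[RHS](count_map (nth false t) P); congr (count P _).
  apply: (@eq_from_nth _ false) => [|i];
    rewrite size_drop st ?size_map ?size_iota // => lti.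
  by rewrite nth_drop (nth_map 0) ?size_iota // nth_iota.
have tE i : (i < c)%N -> nth false t i = (nth 0 w i.+1 < nth 0 w i)%N.
  by move=> ltic; rewrite nth_take // nth_steps; lia.
have desP i : i \in [seq i <- iota a (c - a) | id (nth false t i)] ->
  (a <= i < c)%N /\ descent_at w i.
  rewrite mem_filter mem_iota subnKC ?(ltnW lt_ac) // => /andP[+ /andP[leai ltic]].
  by rewrite leai ltic /= tE // /descent_at => ->; split=> //; lia.
rewrite !countE -(size_map (fun i => (g i).-1)); apply: uniq_leq_size.
  rewrite map_inj_in_uniq ?filter_uniq ?iota_uniq // => i i' /desP[_ di] /desP[_ di'].
  have [/andP[lti _] _ _ ni] := gw _ di; have [/andP[lti' _] _ _ ni'] := gw _ di'.
  move=> eg; have {}eg : g i = g i' by lia.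
  by have [/(ni _ di')|/(ni' _ di)|//] := ltngtP i i'; case; lia.
move=> _ /mapP[i /desP[/andP[leai ltic] di] ->].
have [/andP[lti ltg] up under _] := gw _ di.
have leg := gc i; rewrite leai ltic in leg; have {}leg := leg isT di.
rewrite mem_filter mem_iota subnKC ?(ltnW lt_ac) // tE; last by lia.
rewrite prednK; last by lia.
rewrite -leqNgt; apply/andP; split; last by lia.
have [->|ne] := eqVneq (g i).-1 i; first exact: ltnW.
by apply/ltnW/under; lia.
Qed.

Lemma us_word_size w : us_word w -> (0 < size w)%N.
Proof. by move/us_word_neq0; case: w. Qed.

(** Otherwise all hooks end before the last letter, so the steps other than the last contain at most
    as many descents as ascents; but the whole pattern is balanced and its last step is an
    ascent. *)
Lemma hook_map_last w g : us_word w -> (1 < size w)%N -> hook_map w g ->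
  exists2 i, descent_at w i & g i = (size w).-1.
Proof.
move=> uw gt1 gw; apply: contrapT => no_i.
have [_ ew] := us_word_steps uw.
have eS : steps w = rcons (take (size w - 2) (steps w)) false.
  case: uw gt1 => [//|A B m uA uB _]; rewrite all_cat => /andP[_ ltB] _.
  rewrite steps_join ?us_word_neq0 // -rcons_cons -rcons_cat.
  rewrite -[X in take _ X]cats1 take_size_cat //.
  rewrite !size_cat size_rcons /= !size_steps.
  by have := us_word_size uA; have := us_word_size uB; lia.
have le_g i : (0 <= i < size w - 2)%N -> descent_at w i -> (g i <= size w - 2)%N.
  move=> _ di; have [/andP[_ ltg] _ _ _] := gw _ di.
  have : g i <> (size w).-1 by move=> eg; apply: no_i; exists i.
  by lia.
have lt2 : (size w - 2 < size w)%N by lia.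
have := hook_map_ballot gw lt2 le_g; rewrite drop0.
by move: ew; rewrite {1 2}eS -cats1 !count_cat /=; lia.
Qed.

(** Hooks starting before [i] cannot pass the hook at [i], which reaches the last index, so they end
    by [i]; those starting after [i] end before the last index. Hence both pieces are ballot and
    [us_split_unique] applies. *)
Lemma hook_map_split A B m g i : us_word A -> us_word B -> (head 0 B < last 0 A)%N ->
    all (fun x => x < m)%N (A ++ B) ->
    let w := A ++ rcons B m in
    hook_map w g -> descent_at w i -> g i = (size w).-1 -> i.+1 = size A.
Proof.
move=> uA uB des ltm w gw di gi; have := us_word_size uB;
  have := us_word_size uA => gtA gtB.
have sw : size w = (size A + size B).+1 by rewrite size_cat size_rcons addnS.
have [/andP[ltig _] _ _ ni] := gw _ di.
have tw : take (size w).-1 w = A ++ B by rewrite sw /w -rcons_cat -cats1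
  take_size_cat // size_cat.
suff [eA _] : A = take i.+1 w /\ B = drop i.+1 (A ++ B).
  by rewrite eA size_takel //; lia.
apply: us_split_unique => //.
- rewrite -{1}(cat_take_drop i.+1 (A ++ B)) -{1}tw take_takel //; lia.
- move=> a; rewrite steps_take; apply: (hook_map_ballot gw); first by lia.
  move=> i' /andP[_ lti'] di'; have [/andP[_ ltg'] _ _ ni'] := gw _ di'.
  by have := ni' _ di lti'; lia.
- move=> a; rewrite -tw steps_drop (_ : (size w).-1 = (size w - 2).+1); last by lia.
  rewrite steps_take drop_drop; apply: (hook_map_ballot gw); first by lia.
  move=> i' /andP[lei' _] di'; have [/andP[lt' ltg'] _ _ _] := gw _ di'.
  by have := ni _ di'; lia.
Qed.

Lemma us_word_hook_map w : us_word w -> exists g, hook_map w g.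
Proof.
elim=> {w} [x|A B m uA [gA hA] uB [gB hB] des ltm]; first by exists id.
have := us_word_size uB; have := us_word_size uA => gtA gtB.
pose w := A ++ rcons B m; rewrite -/w; have sw : size w =
  (size A + size B).+1 by rewrite size_cat size_rcons addnS.
have wA i : (i < size A)%N -> nth 0 w i = nth 0 A i by rewrite /w nth_cat => ->.
have wB i : (size A <= i < size A + size B)%N -> nth 0 w i = nth 0 B (i - size A).
  move=> /andP[lei lti]; rewrite /w nth_cat ltnNge lei /= nth_rcons (_ : _ < _)%N //; lia.
have wm : nth 0 w (size A + size B) = m.
  by rewrite /w nth_cat ltnNge leq_addr /= addKn nth_rcons ltnn eqxx.
have ltw i : (i < size A + size B)%N -> (nth 0 w i < m)%N.
  move=> lti; have [ltA|leA] := ltnP i (size A).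
    by rewrite wA // (allP ltm) // mem_cat mem_nth.
  rewrite wB ?leA // (allP ltm) // mem_cat [X in _ || X]mem_nth ?orbT //.
  by rewrite ltn_subLR.
have desE i : descent_at w i ->
    [\/ (i.+1 < size A)%N /\ descent_at A i, i.+1 = size A |
        (size A <= i)%N /\ descent_at B (i - size A)].
  move=> /andP[]; rewrite sw => lti dw; have [ltA|gtA'|eA] := ltngtP i.+1 (size A).
  - by constructor 1; rewrite /descent_at ltA /= -!wA //; lia.
  - constructor 3; have ltB : (i.+1 < size A + size B)%N.
      rewrite ltn_neqAle -ltnS lti andbT; apply: contraTneq dw => ei.
      by rewrite ei wm -leqNgt ltnW // ltw //; lia.
    move: dw; rewrite !wB; try lia.
    by rewrite /descent_at -subSn => [->|]; rewrite ?andbT; lia.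
  - by constructor 2.
(* Hooks of A, then the hook from the last letter of A to the final letter, then the hooks of B
   shifted by the length of A. *)
exists (fun i => if (i.+1 < size A)%N then gA i else
   if (i.+1 == size A)%N then (size A + size B)%N else (size A + gB (i - size A))%N).
move=> i /desE[[ltA dA]|eA|[leA dB]].
- have [/andP[lt1 lt2] up under nc] := hA _ dA; rewrite ltA.
  split; [by lia|by rewrite !wA //; lia|by move=> l /andP[? ?]; rewrite !wA ?under; lia|].
  move=> i' /desE[[ltA' dA']|eA'|[leA' dB']] ltii'.
  + by rewrite ltA'; apply: nc.
  + by left; lia.
  + by left; lia.
- rewrite eA ltnn eqxx wm; split; [by lia|by apply: ltw; lia|by move=> l ?;
    apply: ltw; lia|].
  move=> i' /desE[[ltA' dA']|eA'|[leA' dB']] ltii'; [by lia|by lia|right].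
  have [/andP[lt1 lt2] _ _ _] := hB _ dB'.
  by rewrite !ifF; lia.
- have [/andP[lt1 lt2] up under nc] := hB _ dB; rewrite !ifF; try lia.
  have wBg : nth 0 w (size A + gB (i - size A)) = nth 0 B (gB (i - size A)).
    by rewrite wB ?addKn //; lia.
  rewrite wBg; split; [by lia|by rewrite wB //; lia| |].
    by move=> l ?; rewrite wB ?under //; lia.
  move=> i' /desE[[ltA' dA']|eA'|[leA' dB']] ltii'; [by lia|by lia|].
  have [/andP[lt1' lt2'] _ _ _] := hB _ dB'.
  by rewrite !ifF; try lia; have := nc _ dB'; lia.
Qed.

(** * Permutations and their hook configurations *)

Lemma size_word n (p : 'S_n) : size (word p) = n.
Proof. by rewrite size_map size_enum_ord. Qed.

Lemma nth_word n (p : 'S_n) (i : 'I_n) : nth 0 (word p) i = entry p i.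
Proof. by rewrite (nth_map i) ?size_enum_ord // nth_ord_enum. Qed.

Lemma entry_inj n (p : 'S_n) : injective (entry p).
Proof. by move=> i j /succn_inj/val_inj/perm_inj. Qed.

Lemma word_inj n : injective (@word n).
Proof.
move=> p q epq; apply/permP => i; apply: val_inj; apply: succn_inj.
by rewrite -[LHS]/(entry p i) -nth_word epq nth_word.
Qed.

Lemma word_uniq n (p : 'S_n) : uniq (word p).
Proof. by rewrite map_inj_uniq ?enum_uniq //; apply: entry_inj. Qed.

Lemma word_perm_iota n (p : 'S_n) : perm_eq (word p) (iota 1 n).
Proof.
apply: uniq_perm; rewrite ?word_uniq ?iota_uniq //.
have sub : {subset word p <= iota 1 n}.
  by move=> _ /mapP[i _ ->]; rewrite mem_iota /entry /=; have := ltn_ord (p i); lia.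
by have [] := uniq_min_size (word_uniq p) sub; rewrite ?size_word ?size_iota.
Qed.

Lemma perm_words n :
  perm_eq [seq word p | p <- enum {: 'S_n}] (permutations (iota 1 n)).
Proof.
have u1 : uniq [seq word p | p <- enum {: 'S_n}].
  by rewrite map_inj_uniq ?enum_uniq //; apply: word_inj.
apply: uniq_perm; rewrite ?permutations_uniq //.
have sub : {subset [seq word p | p <- enum {: 'S_n}] <= permutations (iota 1 n)}.
  by move=> _ /mapP[p _ ->]; rewrite mem_permutations word_perm_iota.
have [|//] := uniq_min_size u1 sub.
rewrite size_permutations ?iota_uniq // size_iota size_map -cardE.
by rewrite (eq_card (B := mem [set: 'S_n])) ?cardsT ?card_Sn // => p; rewrite !inE.
Qed.

Lemma card_words n (P : pred (seq nat)) :
  #|[pred p : 'S_n | P (word p)]| = count P (permutations (iota 1 n)).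
Proof.
rewrite -(seq.permP (perm_words n)) count_map cardE -size_filter.
by rewrite enumT /enum_mem; congr size; apply: eq_filter.
Qed.

Lemma wordP n (s : seq nat) : perm_eq s (iota 1 n) -> exists p : 'S_n, word p = s.
Proof.
by rewrite -mem_permutations -(perm_mem (perm_words n)) => /mapP[p _ ->]; exists p.
Qed.

(** Stack-sorting permutes letters, so every duplicate-free preimage is the word of a permutation.
    Positive [n] excludes the empty word, which has one preimage but is not a [us_word]. *)
Lemma uniquely_sortedE n (p : 'S_n) : (0 < n)%N ->
  uniquely_sorted p = `[< us_word (word p) >].
Proof.
move=> n0; apply/idP/asboolP => [/eqP/mem_card1[q qP]|uw].
  have /eqP sq : stack_sort (word q) == word p by have:= qP q; rewrite !inE eqxx => ->.
  rewrite -sq; apply: unique_preimage_us; first exact: word_uniq.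
    by rewrite -size_eq0 size_word -lt0n.
  move=> v uv; rewrite sq => sv; have [q' eq'] : exists q' : 'S_n, word q' = v.
    apply: wordP; apply: perm_trans (word_perm_iota p).
    by rewrite perm_sym -sv stack_sort_perm.
  have := qP q'; rewrite !inE eq' sv eqxx => /esym/eqP eqq; rewrite -eq' eqq //.
have [v [uv sv vP]] := us_word_preimage uw (word_uniq p).
have [q eq] : exists q : 'S_n, word q = v.
  apply: wordP; apply: perm_trans (word_perm_iota p).
  by rewrite perm_sym -sv stack_sort_perm.
apply/eqP; rewrite -(card1 q); apply: eq_card => q'; rewrite !inE.
apply/eqP/eqP => [sq'|->]; last by rewrite eq sv.
by apply: word_inj; rewrite eq; apply: vP; rewrite ?word_uniq.
Qed.

Lemma is_descentE n (p : 'S_n) (i : 'I_n) : is_descent p i = descent_at (word p) i.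
Proof.
apply/existsP/andP; rewrite size_word.
  by case=> j /andP[/eqP ej]; rewrite -!nth_word ej; split=> //; rewrite -ej.
case=> lti; rewrite -[i.+1]/(val (Ordinal lti)) !nth_word => d.
by exists (Ordinal lti); rewrite d andbT.
Qed.

Lemma uniq_map_inj (S T : eqType) (f : S -> T) (s : seq S) :
  uniq [seq f x | x <- s] -> {in s &, injective f}.
Proof.
elim: s => //= a s IHs /andP[na us] x y; rewrite !inE.
move=> /predU1P[->|xs] /predU1P[->|ys] // e; last exact: IHs.
  by rewrite e map_f in na.
by rewrite -e map_f in na.
Qed.

(** * Hooks in the plane versus their combinatorial encoding *)

Section Geometry.
Variables (R : realType) (n : nat) (p : 'S_n).
Implicit Types (h : 'I_n * 'I_n) (z : R * R).
Local Open Scope ring_scope.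
Import Order.TTheory GRing.Theory Num.Theory.

Lemma hook_shapeP h z : hook_shape p h z <->
  (z.1 = (abscissa h.1)%:R /\ (entry p h.1)%:R <= z.2 <= (entry p h.2)%:R) \/
  ((abscissa h.1)%:R <= z.1 <= (abscissa h.2)%:R /\ z.2 = (entry p h.2)%:R).
Proof.
case: z => x y; rewrite /hook_shape; split=> /=.
  by case=> -[/= e1 e2]; [left|right]; rewrite ?in_itv /= in e1 e2.
by case=> -[e1 e2]; [left|right]; split; rewrite /= ?in_itv.
Qed.

Lemma valid_noncrossing H h h' : valid_hook_configuration R p H ->
  h \in H -> h' \in H -> (h.1 < h'.1)%N -> (h.2 <= h'.1)%N \/ (h'.2 < h.2)%N.
Proof.
move=> [hookH _ under disj] hH h'H lt1.
have [le21|lt12] := leqP h.2 h'.1; first by left.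
have [lt22|le22] := ltnP h'.2 h.2; [by right|exfalso].
have up : (entry p h'.1 <= entry p h.2 <= entry p h'.2)%N.
  rewrite ltnW /=; last by apply: under; rewrite ?lt1.
  have [->//|ne] := eqVneq h.2 h'.2; apply/ltnW/(under h') => //.
  by rewrite lt12 ltn_neqAle le22 andbT.
(* The vertical part of [h'] crosses the horizontal part of [h] at this point, which is not a
   permitted common endpoint. *)
have [||||] := disj h h' ((abscissa h'.1)%:R, (entry p h.2)%:R) hH h'H.
- by apply: contraTneq lt1 => ->; rewrite ltnn.
- apply/hook_shapeP; right; split; last exact: erefl.
  by apply/andP; split; rewrite ler_nat ltnS ltnW.
- apply/hook_shapeP; left; split; first exact: erefl.
  by case/andP: up => up1 up2; apply/andP; split; rewrite ler_nat.
- case=> /(congr1 fst)/eqP + _; rewrite eqr_nat => /eqP[e].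
  by rewrite e ltnn in lt12.
- case=> /(congr1 fst)/eqP + _; rewrite eqr_nat => /eqP[e].
  by rewrite e ltnn in lt1.
Qed.

Lemma valid_hook_map H : valid_hook_configuration R p H ->
  exists2 g, hook_map (word p) g & forall h, h \in H ->
    descent_at (word p) h.1 /\ g h.1 = h.2.
Proof.
move=> vH; have [hookH eH under _] := vH.
have inH h : h \in H -> descent_at (word p) h.1.
  move=> hH; rewrite -is_descentE; have: h.1 \in descents p by rewrite -eH map_f.
  by rewrite mem_filter => /andP[].
have hookP i : exists j, descent_at (word p) i ->
    exists2 h, h \in H & nat_of_ord h.1 = i /\ nat_of_ord h.2 = j.
  have [di|_] := boolP (descent_at (word p) i); last by exists 0%N.
  have lti : (i < n)%N by move: di => /andP[]; rewrite size_word => /ltnW.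
  have: Ordinal lti \in descents p by rewrite mem_filter is_descentE di mem_enum.
  by rewrite -eH => /mapP[h hH eh]; exists h.2 => _; exists h; rewrite // -eh.
have [g gP] := choice hookP; exists g.
  move=> i di; have [h hH [e1 <-]] := gP i di; rewrite -e1.
  have /andP[lt12 ltE] := hookH _ hH; split.
  - by rewrite lt12 size_word ltn_ord.
  - by rewrite !nth_word.
  - move=> l lth; have ltl : (l < n)%N.
      by case/andP: lth => _ /ltn_trans; apply; apply: ltn_ord.
    by rewrite -[l]/(val (Ordinal ltl)) !nth_word; apply: under.
  - move=> i' di' lti'; have [h' h'H [e1' <-]] := gP i' di'.
    by rewrite -e1'; apply: (valid_noncrossing vH); rewrite // e1'.
move=> h hH; split; first exact: inH.
have [h' h'H [e1 <-]] := gP _ (inH h hH).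
suff -> : h' = h by [].
have u : uniq [seq x.1 | x <- H] by rewrite eH filter_uniq ?enum_uniq.
by apply: (uniq_map_inj u) => //; apply: val_inj.
Qed.

(** A common point is to the right of [h.1], hence on the horizontal part of [h], at the height of
    [h.2]. A hook [h'] nested under [h] stays below that height, so [h.2 <= h'.1], and the abscissas
    force equality. *)
Lemma noncrossing_meet h h' z : is_hook p h -> is_hook p h' -> (h.1 < h'.1)%N ->
    (h.2 <= h'.1)%N \/ (h'.2 < h.2)%N ->
    (forall l : 'I_n, (h.1 < l < h.2)%N -> (entry p l < entry p h.2)%N) ->
    hook_shape p h z -> hook_shape p h' z ->
  z = plot_point R p h.2 /\ z = plot_point R p h'.1.
Proof.
case: z => x y /andP[lt1 lt2] /andP[lt1' lt2'] lt nc under.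
move=> /hook_shapeP hz /hook_shapeP hz'; move: hz hz' => /=.
rewrite /abscissa => hz hz'.
have x'ge : (h'.1.+1)%:R <= x.
  by case: hz' => -[]; [move=> ->|move=> /andP[]].
have x'le : x <= (h'.2.+1)%:R.
  by case: hz' => -[]; [move=> -> _; rewrite ler_nat ltnS ltnW|move=> /andP[]].
have y'le : y <= (entry p h'.2)%:R.
  by case: hz' => -[]; [move=> _ /andP[]|move=> _ ->].
have [xle ye] : x <= (h.2.+1)%:R /\ y = (entry p h.2)%:R.
  case: hz => -[]; last by move=> /andP[].
  by move=> ex; move: x'ge; rewrite ex ler_nat ltnS leqNgt lt.
case: nc => [le21|lt22]; last first.
  by move: y'le; rewrite ye ler_nat leqNgt under // (ltn_trans lt lt1').
have e : h.2 = h'.1.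
  apply: val_inj; apply/eqP; rewrite eqn_leq le21 /= -ltnS -(ler_nat R).
  exact: le_trans x'ge xle.
have ex : x = (h'.1.+1)%:R by apply/eqP; rewrite eq_le x'ge -e xle.
by rewrite /plot_point /abscissa ex ye e.
Qed.

Lemma hook_map_valid g : hook_map (word p) g ->
  exists2 H, valid_hook_configuration R p H &
    forall h, h \in H <-> descent_at (word p) h.1 /\ nat_of_ord h.2 = g h.1.
Proof.
move=> gw; pose H := [seq (i, insubd i (g i)) | i : 'I_n <- descents p].
have HP h : h \in H <-> descent_at (word p) h.1 /\ nat_of_ord h.2 = g h.1.
  split=> [/mapP[i]|[dh gh]].
    rewrite mem_filter is_descentE => /andP[di _] -> /=; split=> //.
    have [/andP[_ ltg] _ _ _] := gw _ di; rewrite size_word in ltg.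
    by rewrite val_insubd ltg.
  apply/mapP; exists h.1; first by rewrite mem_filter is_descentE dh mem_enum.
  case: h dh gh => i j /= dh gh; congr (_, _); apply: val_inj.
  by rewrite val_insubd -gh ltn_ord.
have hookH h : h \in H -> is_hook p h.
  move=> /HP[dh gh]; have [/andP[lt1 _] lt2 _ _] := gw _ dh.
  by rewrite -gh in lt1 lt2; rewrite /is_hook lt1 -!nth_word.
have under h (l : 'I_n) : h \in H -> (h.1 < l < h.2)%N -> (entry p l < entry p h.2)%N.
  move=> /HP[dh gh]; have [_ _ und _] := gw _ dh.
  by rewrite -gh in und => /und; rewrite !nth_word.
have meet h h' z : h \in H -> h' \in H -> (h.1 < h'.1)%N ->
    hook_shape p h z -> hook_shape p h' z ->
    z = plot_point R p h.2 /\ z = plot_point R p h'.1.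
  move=> hH h'H lt; apply: noncrossing_meet; rewrite ?hookH //; last by move=> l;
    apply: under.
  move: hH h'H => /HP[dh gh] /HP[dh' gh']; have [_ _ _ nc] := gw _ dh.
  by rewrite gh gh'; apply: nc.
exists H => //; split=> //; first by rewrite -map_comp map_id.
move=> h h' z hH h'H ne hz h'z.
have [lt|lt|eq] := ltngtP h.1 h'.1; [by left; apply: meet|by right;
  apply/and_comm; apply: meet|].
case/eqP: ne; move: hH h'H => /mapP[i _ eh] /mapP[i' _ eh'].
by move: eq; rewrite eh eh' => /= /val_inj ->.
Qed.
End Geometry.

Lemma is_eyeE (R : realType) n (p : 'S_n) A B m e : us_word A -> us_word B ->
    (head 0 B < last 0 A)%N -> all (fun x => x < m)%N (A ++ B) ->
    word p = A ++ rcons B m ->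
  is_eye R p e <-> e = head 0 B.
Proof.
move=> uA uB des ltm ew; have uw : us_word (word p) by rewrite ew; apply: us_word_split.
have := us_word_size uA; have := us_word_size uB => gtB gtA.
have sw : n = (size A + size B).+1 by rewrite -(size_word p) ew size_cat size_rcons addnS.
have n0 : (0 < n)%N by rewrite sw.
have predn : n.-1 = (size A + size B)%N by rewrite sw.
have nthw (i : 'I_n) : entry p i = nth 0 (rcons (A ++ B) m) i
  by rewrite rcons_cat -ew nth_word.
have maxw (i : 'I_n) : (i < n.-1)%N -> (entry p i < m)%N.
  rewrite predn -size_cat => lti; rewrite nthw nth_rcons lti.
  exact/(allP ltm)/mem_nth.
have lastw (i : 'I_n) : nat_of_ord i = n.-1 -> entry p i = m.
  by rewrite predn -size_cat => ei; rewrite nthw nth_rcons ei ltnn eqxx.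
have eyew (j : 'I_n) : nat_of_ord j = size A -> entry p j = head 0 B.
  by move=> ej; rewrite -nth_word ew nth_cat ej ltnn subnn; case: (B) gtB.
have gt1 : (1 < size (word p))%N by rewrite size_word; lia.
have split_at g i : hook_map (word p) g -> descent_at (word p) i ->
    g i = n.-1 -> i.+1 = size A.
  rewrite -{3}(size_word p) ew; exact: hook_map_split.
(* Some hook ends at the last letter, which is the largest, so the top hook must end there too. *)
have top_last (H : seq ('I_n * 'I_n)) g t : hook_map (word p) g ->
    (forall h, h \in H -> descent_at (word p) h.1 /\ g h.1 = h.2) ->
    (forall i, descent_at (word p) i -> exists2 h : 'I_n * 'I_n, h \in H &
      nat_of_ord h.1 = i) ->
    is_top_hook p H t -> nat_of_ord t.2 = n.-1.
  move=> gw gH Hd [tH top]; have [i di gi] := hook_map_last uw gt1 gw.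
  have [h hH ei] := Hd i di; have [_ gh] := gH h hH.
  rewrite -ei gh size_word in gi; have := top h hH; rewrite (lastw _ gi) leqNgt => ntop.
  apply/eqP; rewrite eqn_leq -ltnS prednK ?ltn_ord //= leqNgt.
  by apply: contra ntop; apply: maxw.
split.
  case=> H [t [j [vH top jt jmin <-]]]; have [g gw gH] := valid_hook_map vH.
  have t2 : nat_of_ord t.2 = n.-1.
    apply: (top_last H g) => // i di; have [_ eH _ _] := vH.
    have lti : (i < n)%N by move: di => /andP[]; rewrite size_word => /ltnW.
    have: Ordinal lti \in descents p by rewrite mem_filter is_descentE di mem_enum.
    by rewrite -eH => /mapP[h hH eh]; exists h; rewrite // -eh.
  have [dt gt] := gH t (proj1 top); rewrite t2 in gt.
  have eA := split_at g _ gw dt gt.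
  apply: eyew; have ltA : (size A < n)%N by lia.
  apply/eqP; rewrite eqn_leq; move: jt; rewrite inE -eA => /andP[-> _]; rewrite andbT.
  have := jmin (Ordinal ltA); rewrite inE /= eA; apply.
  by rewrite -eA ltnSn t2 predn /=; lia.
move=> ->; have [g gw] := us_word_hook_map uw.
have [H vH HP] := hook_map_valid R gw.
have [i di gi] := hook_map_last uw gt1 gw; rewrite size_word in gi.
have eA := split_at g i gw di gi.
have lti : (i < n)%N by lia.
have ltn1 : (n.-1 < n)%N by lia.
have ltA : (size A < n)%N by lia.
exists H, (Ordinal lti, Ordinal ltn1), (Ordinal ltA); split=> //=.
- split; first by apply/HP.
  move=> h hH /=; rewrite (lastw (Ordinal ltn1)) //.
  have : (h.2 <= n.-1)%N by rewrite -ltnS prednK ?ltn_ord.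
  by rewrite leq_eqVlt => /orP[/eqP/lastw->|/maxw/ltnW].
- by rewrite inE /=; lia.
- by move=> l; rewrite inE /= => /andP[]; lia.
- exact: eyew.
Qed.

(** * Counting *)

(** The letterwise counterpart of [splitn]: sums that only see sizes are transferred by
    [big_splits_size]. *)
Fixpoint splits (s : seq nat) : seq (seq nat * seq nat) :=
  if s is x :: s' then
    [seq (x :: c.1, c.2) | c <- splits s'] ++ [seq (c.1, x :: c.2) | c <- splits s']
  else [:: ([::], [::])].

Lemma splits_subseq s c : c \in splits s -> subseq c.1 s /\ subseq c.2 s.
Proof.
elim: s c => [|x s IHs] c; first by rewrite inE => /eqP->.
rewrite mem_cat => /orP[] /mapP[d /IHs[s1 s2] ->] /=; rewrite ?eqxx;
  by split=> //; apply: subseq_trans (subseq_cons _ _).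
Qed.

Lemma splits_perm s c : c \in splits s -> perm_eq (c.1 ++ c.2) s.
Proof.
elim: s c => [|x s IHs] c; first by rewrite inE => /eqP->.
rewrite mem_cat => /orP[] /mapP[d /IHs ds ->] /=; first by rewrite perm_cons.
by rewrite perm_catC /= perm_cons perm_catC.
Qed.

Lemma splits_filter (P : pred nat) s : ([seq x <- s | P x], [seq x <- s | ~~ P
  x]) \in splits s.
Proof.
elim: s => //= x s IHs; rewrite mem_cat; apply/orP.
by case: (P x) => /=; [left|right]; apply: (map_f _ IHs).
Qed.

Lemma splits_uniq s : uniq s -> uniq (splits s).
Proof.
elim: s => // x s IHs /andP[nx us]; rewrite [splits _]/= cat_uniq.
rewrite !map_inj_uniq ?IHs //=; try by move=> [a b] [a' b'] [-> ->].
rewrite andbT; apply/hasPn => _ /mapP[c cs ->]; apply/mapP => -[d ds [e _]].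
have [sc _] := splits_subseq cs; case/negP: nx; apply: (mem_subseq sc).
by rewrite e inE eqxx.
Qed.

Lemma big_splits_cons (M : nmodType) (G : seq nat -> seq nat -> M) x s :
  (\sum_(c <- splits (x :: s)) G c.1 c.2 =
   \sum_(c <- splits s) G (x :: c.1) c.2 + \sum_(c <- splits s) G c.1 (x :: c.2))%R.
Proof. by rewrite big_cat !big_map. Qed.

Lemma big_splits_cat (M : nmodType) (G : seq nat -> seq nat -> M) s t :
  (\sum_(c <- splits (s ++ t)) G c.1 c.2 =
   \sum_(a <- splits s) \sum_(b <- splits t) G (a.1 ++ b.1) (a.2 ++ b.2))%R.
Proof.
elim: s G => [|x s IHs] G; first by rewrite big_seq1.
rewrite cat_cons big_splits_cons (IHs (fun a b => G (x :: a) b)).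
rewrite (IHs (fun a b => G a (x :: b))).
by rewrite -(big_splits_cons (fun u v => \sum_(b <- splits t) G (u ++ b.1) (v ++ b.2))%R).
Qed.

Lemma big_splits_size (M : nmodType) (g : nat -> nat -> M) s :
  (\sum_(c <- splits s) g (size c.1) (size c.2) =
    \sum_(q <- splitn (size s)) g q.1 q.2)%R.
Proof.
elim: s g => [|x s IHs] g; first by rewrite !big_seq1.
rewrite (big_splits_cons (fun a b => g (size a) (size b))) big_cat !big_map /=.
by rewrite (IHs (fun a b => g a.+1 b)) (IHs (fun a b => g a b.+1)).
Qed.

Lemma big_splits_all (M : nmodType) (Q : pred nat) (G : seq nat -> seq nat -> M) s :
    all (predC Q) s ->
  (\sum_(c <- splits s | all Q c.1) G c.1 c.2 = G [::] s)%R.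
Proof.
elim: s G => [|y s IHs] G /=; first by rewrite big_cons big_nil /= GRing.addr0.
case/andP=> /negbTE Qy Qs; rewrite big_cat !big_map /= Qy big_pred0_eq GRing.add0r.
exact: (IHs (fun a b => G a (y :: b))).
Qed.

(** The letter y at position p exceeds all of the first part exactly when [drop p s] lies wholly in
    the second part; only [take p s] is still free. *)
Lemma big_splits_pivot (M : nmodType) (G : seq nat -> seq nat -> nat ->
  M) s : sorted ltn s ->
  (\sum_(c <- splits s) \sum_(y <- c.2 | all (fun z => z < y)%N c.1) G c.1 c.2 y =
   \sum_(p < size s) \sum_(c <- splits (take p s))
      G c.1 (c.2 ++ drop p s) (nth 0%N s p))%R.
Proof.
elim: s G => [|x s IHs] G ss; first by rewrite big_ord0 big_seq1 big_nil.
have ss' := path_sorted ss; have xs : all (fun z => x < z)%N s :=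
  order_path_min ltn_trans ss.
rewrite (big_splits_cons (fun a b => \sum_(y <- b | all (fun z => z < y)%N a) G a b y)%R).
(* If the least letter x is itself the pivot, the first part must be empty: this is the term
   [p = 0]. *)
rewrite [X in (_ + X)%R](_ : _ = G [::] (x :: s) x +
  \sum_(c <- splits s) \sum_(y <- c.2 | all (fun z =>
    z < y)%N c.1) G c.1 (x :: c.2) y)%R; last first.
  rewrite -(big_splits_all (Q := fun z => z < x)%N (fun a b => G a (x :: b) x));
    last first.
    by apply: sub_all xs => z /=; rewrite -leqNgt => /ltnW.
  rewrite [X in (X + _)%R]big_mkcond -big_split; apply: eq_bigr => c _ /=.
  by rewrite big_cons; case: ifP; rewrite ?GRing.add0r.
rewrite big_ord_recl /= big_seq1 /= GRing.addrCA; congr (_ + _)%R.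
under [RHS]eq_bigr => p _ do
  rewrite (big_splits_cons (fun a b => G a (b ++ drop p s) (nth 0%N s p))).
rewrite big_split /= -(IHs (fun a b y => G a (x :: b) y)) //.
rewrite -(IHs (fun a b y => G (x :: a) b y)) //; congr (_ + _)%R.
rewrite [LHS]big_seq [RHS]big_seq; apply: eq_bigr => c /splits_subseq[_ sc].
rewrite [LHS]big_seq_cond [RHS]big_seq_cond; apply: eq_bigl => y /=.
by case: (boolP (y \in c.2)) => //= /(mem_subseq sc)/(allP xs)->.
Qed.

Definition us_words (s : seq nat) := [seq w <- permutations s | `[< us_word w >]].

Lemma us_wordsP s w : reflect (us_word w /\ perm_eq w s) (w \in us_words s).
Proof.
rewrite mem_filter mem_permutations.
by apply: (iffP andP) => -[/asboolP].
Qed.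

Lemma us_words_uniq s : uniq (us_words s).
Proof. by rewrite filter_uniq ?permutations_uniq. Qed.

(* The pairs left after deleting the last (and largest) letter of a uniquely
  sorted word. *)
Definition us_pairs (s : seq nat) : seq (seq nat * seq nat) :=
  [seq q <- [seq q | c <- splits s,
                     q <- [seq (a, b) | a <- us_words c.1, b <- us_words c.2]]
     | head 0 q.2 < last 0 q.1].

Lemma us_pairsP s q : uniq s -> reflect
  [/\ us_word q.1, us_word q.2, (head 0 q.2 < last 0 q.1)%N & perm_eq (q.1 ++ q.2) s]
  (q \in us_pairs s).
Proof.
move=> us; rewrite mem_filter; apply: (iffP andP).
  case=> des /allpairsPdep[c [_ [cs /allpairsP[[a b] [/us_wordsP[ua pa]
    /us_wordsP[ub pb] ->]] eq]]].
  rewrite eq /= in des *; split=> //.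
  exact: perm_trans (perm_cat pa pb) (splits_perm cs).
case: q => a b /= [ua ub des pab]; split=> //; apply/allpairsPdep.
exists ([seq x <- s | x \in a], [seq x <- s | x \notin a]), (a, b); split=> //.
  exact: splits_filter.
have uab : uniq (a ++ b) by rewrite (perm_uniq pab).
have pf P : perm_eq [seq x <- s | P x] [seq x <- a ++ b | P x]
  by rewrite perm_filter // perm_sym.
move: uab; rewrite cat_uniq => /and3P[uqa /hasPn nab uqb].
apply: allpairs_f; apply/us_wordsP; split=> //=; rewrite perm_sym (perm_trans (pf _)) //.
  rewrite filter_cat (eq_in_filter (a2 := predT)) ?filter_predT; last by [].
  by rewrite (eq_in_filter (a2 := pred0)) ?filter_pred0 ?cats0 // => x /nab/negbTE.
rewrite filter_cat (eq_in_filter (a2 := pred0)) ?filter_pred0; last by move=> x /= ->.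
by rewrite (eq_in_filter (a2 := predT)) ?filter_predT // => x /nab.
Qed.

(** A pair determines its split: a subsequence of a duplicate-free [s] is recovered from its set of
    letters. *)
Lemma us_pairs_uniq s : uniq s -> uniq (us_pairs s).
Proof.
move=> us; apply: filter_uniq; apply: allpairs_uniq_dep; first exact: splits_uniq.
  by move=> c _; apply: allpairs_uniq; rewrite ?us_words_uniq // => -[? ?] [? ?].
move=> [c q] [c' q'] /allpairsPdep[d [r [ds rd e]]] /allpairsPdep[d' [r' [ds' rd'
  e']]] /= eq.
case: e e' eq rd rd' => -> {c} -> {q} [-> -> {c' q'}] <- {r'}.
move=> /allpairsP[[a b] [/us_wordsP[_ pa] /us_wordsP[_ pb] ->]].
move=> /allpairsP[[a' b'] [/us_wordsP[_ pa'] /us_wordsP[_ pb'] [ea eb]]].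
have [s1 s2] := splits_subseq ds; have [s1' s2'] := splits_subseq ds'.
suff -> : d = d' by [].
rewrite [d]surjective_pairing [d']surjective_pairing.
rewrite (subseq_uniqP us s1) (subseq_uniqP us s1') (subseq_uniqP us s2)
  (subseq_uniqP us s2').
congr pair; apply: eq_filter => x; last by rewrite -(perm_mem pb) eb (perm_mem pb').
by rewrite -(perm_mem pa) ea (perm_mem pa').
Qed.

Lemma us_word_suffix_ballot w : us_word w -> suffix_ballot (steps w).
Proof.
move=> /us_word_steps[pw ew] i; have := pw i.
by move: ew; rewrite -{1 2}(cat_take_drop i (steps w)) !count_cat; lia.
Qed.

Lemma us_word_split_inj A B A' B' m m' : us_word A -> us_word B ->
    (head 0 B < last 0 A)%N -> us_word A' -> us_word B' ->
  A ++ rcons B m = A' ++ rcons B' m' -> [/\ A = A', B = B' & m = m'].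
Proof.
move=> uA uB des uA' uB'; rewrite -!rcons_cat => /rcons_inj[e em].
by have [] := us_split_unique uA uB des e (us_word_suffix_ballot uA')
  (us_word_suffix_ballot uB').
Qed.

Lemma us_words_rcons s m : s != [::] -> sorted ltn (rcons s m) ->
  perm_eq (us_words (rcons s m)) [seq q.1 ++ rcons q.2 m | q <- us_pairs s].
Proof.
move=> s0 ss; have usm := sorted_uniq ltn_trans ltnn ss.
have ltm : all (fun x => x < m)%N s.
  move: ss; rewrite -rev_sorted rev_rcons /= => /(order_path_min (rev_trans ltn_trans)).
  by rewrite all_rev.
have us : uniq s by move: usm; rewrite rcons_uniq => /andP[].
apply: uniq_perm; first exact: us_words_uniq.
  rewrite map_inj_in_uniq ?us_pairs_uniq // => q q' /(us_pairsP _ us)[ua ub des _].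
  case/(us_pairsP _ us)=> ua' ub' _ _ e.
  have [eA eB _] := us_word_split_inj ua ub des ua' ub' e.
  by rewrite [q]surjective_pairing eA eB -surjective_pairing.
move=> w; apply/us_wordsP/mapP => [[uw pw]|[q /(us_pairsP _ us)[ua ub des pab]
  ->]]; last first.
  split; last by rewrite -rcons_cat -!cats1 perm_cat.
  by apply: us_word_split => //; rewrite (perm_all _ pab).
case: uw pw => [x|A B m' uA uB des ltm'].
  by move/perm_size; rewrite size_rcons => -[] /esym/size0nil e; rewrite e in s0.
rewrite -rcons_cat => pw.
have em : m' = m.
  have: m \in rcons (A ++ B) m' by rewrite (perm_mem pw) mem_rcons mem_head.
  have: m' \in rcons s m by rewrite -(perm_mem pw) mem_rcons mem_head.
  rewrite !mem_rcons !inE => /predU1P[//|m's] /predU1P[//|ms].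
  by have := allP ltm _ m's; have /(_ _ ms) := allP ltm'; lia.
exists (A, B); last by rewrite em rcons_cat.
by apply/us_pairsP => //; split=> //; move: pw; rewrite em -!cats1 perm_cat2r.
Qed.

Lemma us_word_map f w : {in w &, {homo f : x y / (x < y)%N}} -> us_word w ->
  us_word (map f w).
Proof.
move=> fw uw; elim: uw fw => {w} [x _|A B m uA IHA uB IHB des ltm fw];
  first exact: us_word1.
have A0 := us_word_neq0 uA; have B0 := us_word_neq0 uB.
have hB : head 0 B \in B by case: (B) B0 => //= *; apply: mem_head.
have lA : last 0 A \in A by case: (A) A0 => //= *; apply: mem_last.
have inA x : x \in A -> x \in A ++ rcons B m by rewrite mem_cat => ->.
have inB x : x \in B -> x \in A ++ rcons B m
  by rewrite mem_cat mem_rcons inE orbA orbC => ->.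
rewrite map_cat map_rcons; apply: us_word_split.
- by apply: IHA => x y /inA ? /inA ?; apply: fw.
- by apply: IHB => x y /inB ? /inB ?; apply: fw.
- have -> : head 0 (map f B) = f (head 0 B) by case: (B) B0.
  have -> : last 0 (map f A) = f (last 0 A) by case: (A) A0 => //= *; rewrite last_map.
  by apply: fw; [apply: inB|apply: inA|].
rewrite -map_cat all_map; apply/allP => x xAB /=; apply: fw; last exact: (allP ltm).
  by move: xAB; rewrite mem_cat => /orP[/inA|/inB].
by rewrite mem_cat mem_rcons mem_head orbT.
Qed.

(** Only the relative order of letters matters; [nth 0 s] is an order isomorphism onto [s], with
    inverse [index]. *)
Lemma us_words_nth s : sorted ltn s ->
  perm_eq (us_words s) [seq map (nth 0 s) w | w <- us_words (iota 0 (size s))].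
Proof.
move=> ss; have us := sorted_uniq ltn_trans ltnn ss.
have nth_homo : {in iota 0 (size s) &, {homo nth 0 s : i j / (i < j)%N}}.
  by move=> i j; rewrite !mem_iota => ? ?; apply: (sorted_ltn_nth ltn_trans).
have nthK : {in iota 0 (size s), cancel (nth 0 s) (index^~ s)}.
  by move=> i; rewrite mem_iota => lti; rewrite index_uniq.
have index_homo : {in s &, {homo index^~ s : x y / (x < y)%N}}.
  move=> x y xs ys; rewrite !ltnNge; apply: contra; rewrite leq_eqVlt => /predU1P[e|lt].
    by rewrite -(nth_index 0 xs) -e nth_index.
  by rewrite -(nth_index 0 xs) -[leqLHS](nth_index 0 ys) ltnW // nth_homo
    ?mem_iota ?index_mem.
have nth_inj : {in us_words (iota 0 (size s)) &, injective (map (nth 0 s))}.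
  have vK v : v \in us_words (iota 0 (size s)) -> map (index^~ s) (map (nth 0 s) v) = v.
    move=> /us_wordsP[_ pv]; rewrite -map_comp map_id_in // => i.
    by rewrite (perm_mem pv); apply: nthK.
  by move=> v v' /vK {2}<- /vK {2}<- ->.
apply: uniq_perm; rewrite ?map_inj_in_uniq ?us_words_uniq // => w.
apply/us_wordsP/mapP => [[uw pw]|[v /us_wordsP[uv pv] ->]]; last first.
  split; last by rewrite -{2}(mkseq_nth 0 s) perm_map.
  by apply: us_word_map => // i j; rewrite !(perm_mem pv); apply: nth_homo.
exists (map (index^~ s) w); last first.
  by rewrite -map_comp map_id_in // => x; rewrite (perm_mem pw); apply: nth_index.
apply/us_wordsP; split.
  by apply: us_word_map => // x y; rewrite !(perm_mem pw); apply: index_homo.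
by rewrite (perm_trans (perm_map _ pw)) // -{2}(mkseq_nth 0 s) -map_comp map_id_in.
Qed.

Definition us_count (s : seq nat) (x : nat) :=
  count (fun w => head 0 w == x) (us_words s).

Lemma us_words_head s w : w \in us_words s -> head 0 w \in s.
Proof.
case/us_wordsP=> uw pw; rewrite -(perm_mem pw).
by have := us_word_neq0 uw; case: (w) => //= *; apply: mem_head.
Qed.

Lemma us_count_notin s x : x \notin s -> us_count s x = 0%N.
Proof.
move=> nx; apply/eqP; rewrite -leqn0 leqNgt -has_count;
  apply/hasPn => w /us_words_head ws.
by apply: contraNneq nx => <-.
Qed.

Section Enumeration.
Local Open Scope ring_scope.
Import GRing.Theory.

(* The words with i letters smaller and j letters larger than the first one. *)
Definition us_egf : egf := fun i j => (us_count (iota 0 (i + j).+1) i)%:R.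
Definition us_total (n : nat) : int := (size (us_words (iota 0 n)))%:R.

Lemma size_us_words s : sorted ltn s -> (size (us_words s))%:R = us_total (size s).
Proof. by move=> ss; rewrite (perm_size (us_words_nth ss)) size_map. Qed.

Lemma us_count_egf lo x hi : sorted ltn (lo ++ x :: hi) ->
  (us_count (lo ++ x :: hi) x)%:R = us_egf (size lo) (size hi).
Proof.
set s := lo ++ x :: hi => ss; have us := sorted_uniq ltn_trans ltnn ss.
have sz : size s = (size lo + size hi).+1 by rewrite size_cat /= addnS.
have xE : x = nth 0%N s (size lo) by rewrite nth_cat ltnn subnn.
rewrite /us_count (seq.permP (us_words_nth ss)) count_map /us_egf -sz; congr (_%:R).
apply: eq_in_count => w ws /=; have hw := us_words_head ws.
move: ws => /us_wordsP[uw _]; have w0 := us_word_neq0 uw.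
have -> : head 0%N (map (nth 0%N s) w) = nth 0%N s (head 0%N w) by case: (w) w0.
rewrite {1}xE nth_uniq //; first by move: hw; rewrite mem_iota.
by rewrite sz ltnS leq_addr.
Qed.

Lemma count_sumr (I : Type) (P : pred I) (s : seq I) :
  (count P s)%:R = \sum_(i <- s) (P i)%:R :> int.
Proof.
by elim: s => [|i s IHs]; rewrite ?big_nil ?big_cons //= natrD IHs.
Qed.

(** The last letter of [a] is the maximum of [c.1], and it differs from the head of [b] by
    disjointness. So the descent condition depends on [c.1] and that head only, and the sums over
    [a] and [b] decouple. *)
Lemma count_us_pairs (P : pred (seq nat * seq nat)) s : uniq s ->
  (count P (us_pairs s))%:R = \sum_(c <- splits s) \sum_(a <- us_words c.1)
    \sum_(b <- us_words c.2) (~~ all (fun z => z < head 0 b)%N c.1 && P (a, b))%:R :> int.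
Proof.
move=> us; rewrite count_filter count_sumr big_allpairs_dep big_seq [RHS]big_seq.
apply: eq_bigr => c cs; rewrite big_allpairs big_seq [RHS]big_seq.
apply: eq_bigr => a ac; rewrite big_seq [RHS]big_seq; apply: eq_bigr => b bc /=.
rewrite andbC; congr ((_ && _)%:R).
have hb := us_words_head bc; move: ac => /us_wordsP[ua pa].
have la : last 0%N a \in c.1.
  by rewrite -(perm_mem pa); have := us_word_neq0 ua; case: (a) => //= *; apply: mem_last.
have ucs : uniq (c.1 ++ c.2) by rewrite (perm_uniq (splits_perm cs)).
have lP : all (fun z => z <= last 0 a)%N c.1 by rewrite -(perm_all _ pa) us_word_last.
apply/idP/allPn => [lt|[z zc]].
  by exists (last 0%N a); rewrite // -leqNgt ltnW.
rewrite -leqNgt => /leq_trans/(_ (allP lP _ zc)); rewrite leq_eqVlt => /predU1P[e|//].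
by move: ucs; rewrite cat_uniq => /and3P[_ /hasPn/(_ _ hb)]; rewrite e la.
Qed.

Lemma sum_us_words_head (F : nat -> int) s : uniq s ->
  \sum_(w <- us_words s) F (head 0%N w) = \sum_(y <- s) F y * (us_count s y)%:R.
Proof.
move=> us; under [RHS]eq_bigr => y _ do rewrite /us_count count_sumr mulr_sumr.
rewrite exchange_big /= big_seq [RHS]big_seq; apply: eq_bigr => w /us_words_head ws.
rewrite (bigD1_seq (head 0%N w)) //= eqxx mulr1 big1 ?addr0 // => y.
by rewrite eq_sym => /negbTE->; rewrite mulr0.
Qed.

Lemma egf_mul_splits (f g : egf) (s t : seq nat) :
  egf_mul f g (size s) (size t) = \sum_(a <- splits s) \sum_(b <- splits t)
    f (size a.1) (size b.1) * g (size a.2) (size b.2).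
Proof.
rewrite /egf_mul -(big_splits_size (fun i i' =>
  \sum_(r <- splitn (size t)) f i r.1 * g i' r.2)).
apply: eq_bigr => a _.
by rewrite (big_splits_size (fun j j' => f (size a.1) j * g (size a.2) j')).
Qed.

Section Pairs.
Variables (lo hi : seq nat) (x : nat).
Hypothesis ss : sorted ltn (lo ++ x :: hi).

Let us : uniq (lo ++ x :: hi) := sorted_uniq ltn_trans ltnn ss.

Lemma pivot_bounds : all (fun y => y < x)%N lo /\ all (fun y => x < y)%N hi.
Proof.
move: ss; rewrite (sorted_pairwise ltn_trans) pairwise_cat allrel_consr /=.
by case/and3P=> /andP[lox _] _ /andP[xhi _].
Qed.

Lemma count_us_pairs_first :
  (count (fun q => head 0%N q.1 == x) (us_pairs (lo ++ x :: hi)))%:R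
    = (egf_sub (egf_mul (egf_t us_total) us_egf) (egf_int us_egf us_egf)) (size
      lo) (size hi).
Proof.
have [lox xhi] := pivot_bounds.
pose G u v : int := (us_count u x)%:R * (size (us_words v))%:R -
  \sum_(y <- v | all (fun z => z < y)%N u) (us_count u x)%:R * (us_count v y)%:R.
transitivity (\sum_(c <- splits (lo ++ x :: hi)) G c.1 c.2).
  rewrite count_us_pairs // big_seq [RHS]big_seq; apply: eq_bigr => c cs; rewrite /G.
  have uc2 : uniq c.2 by have [_ /subseq_uniq->] := splits_subseq cs.
  rewrite -mulr_sumr -mulrBr.
  have -> : \sum_(y <- c.2 | all (fun z => z < y)%N c.1) (us_count c.2 y)%:R =
      \sum_(y <- c.2) (all (fun z => z < y)%N c.1)%:R * (us_count c.2 y)%:R :> int.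
    by rewrite big_mkcond; apply: eq_bigr => y _; case: (all _ _); rewrite ?mul1r ?mul0r.
  rewrite -(sum_us_words_head (fun y => (all (fun z => z < y)%N c.1)%:R)) //.
  rewrite -[size (us_words c.2)]sum1_size natr_sum -sumrB.
  rewrite /us_count count_sumr mulr_suml; apply: eq_bigr => a _.
  rewrite mulr_sumr; apply: eq_bigr => b _ /=.
  by case: (all _ _); case: eqP => _ /=; ring.
rewrite big_splits_cat.
under eq_bigr => a _ do
  rewrite (big_splits_cons (fun u v => G (a.1 ++ u) (a.2 ++ v))).
pose g (a b : seq nat * seq nat) : int :=
  us_egf (size a.1) (size b.1) * us_total (size a.2 + size b.2).
pose h (a b : seq nat * seq nat) : int := \sum_(y <- b.2 | all (fun z => z < y)%N b.1)
   us_egf (size a.1) (size b.1) * (us_count (a.2 ++ b.2) y)%:R.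
transitivity (\sum_(a <- splits lo) \sum_(b <- splits hi) (g a b - h a b)).
  rewrite big_seq [RHS]big_seq; apply: eq_bigr => a /splits_subseq[a1 a2].
  rewrite -big_split big_seq [RHS]big_seq; apply: eq_bigr => b /splits_subseq[b1 b2] /=.
  have sub1 : subseq (a.1 ++ x :: b.1) (lo ++ x :: hi) by rewrite cat_subseq //= eqxx.
  have sub2 : subseq (a.2 ++ b.2) (lo ++ x :: hi).
    by rewrite cat_subseq // (subseq_trans b2) // subseq_cons.
  have so1 := subseq_sorted ltn_trans sub1 ss;
    have so2 := subseq_sorted ltn_trans sub2 ss.
  have nx : x \notin a.1 ++ b.1.
    by have := sorted_uniq ltn_trans ltnn so1;
      rewrite uniq_catC cons_uniq mem_cat orbC -mem_cat => /andP[].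
  (* Placing x in the second part contributes nothing, since x must start A. *)
  rewrite [X in _ + X]/G (us_count_notin nx) mul0r big1 ?subr0 ?addr0; last first.
    by move=> y _; rewrite mul0r.
  rewrite /G us_count_egf // size_us_words // size_cat /g /h; congr (_ - _).
  (* A head of B above all of A exceeds x, so it is taken from [hi]. *)
  rewrite big_cat /= big_seq_cond big1 ?add0r; last first.
    move=> y /andP[/(mem_subseq a2)/(allP lox) yx]; rewrite all_cat /= => /and3P[_ xy _].
    by move: (ltn_trans xy yx); rewrite ltnn.
  rewrite big_seq_cond [RHS]big_seq_cond; apply: eq_bigl => y; rewrite all_cat /=.
  case: (boolP (y \in b.2)) => //= /(mem_subseq b2)/(allP xhi) xy; rewrite xy /=.
  rewrite (_ : all _ a.1) //; apply/allP => z /(mem_subseq a1)/(allP lox) zx.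
  exact: ltn_trans zx xy.
under eq_bigr => a _ do rewrite sumrB.
rewrite sumrB egf_subE; congr (_ - _).
  rewrite egf_mulC egf_mul_splits; apply: eq_bigr => a _; exact: eq_bigr.
rewrite /egf_int -(big_splits_size (fun i i' => \sum_(p < size hi) \sum_(r <- splitn p)
    us_egf i r.1 * us_egf (i' + r.2)%N (size hi - p.+1)%N)).
rewrite big_seq [RHS]big_seq; apply: eq_bigr => a /splits_subseq[a1 a2].
rewrite /h (big_splits_pivot (fun u v y =>
  us_egf (size a.1) (size u) * (us_count (a.2 ++ v) y)%:R)); last first.
  by move: ss; rewrite sorted_cat_cons => /andP[_ /path_sorted].
apply: eq_bigr => p _.
have sp : size (take p hi) = p by rewrite size_takel // ltnW.
rewrite -[in RHS]sp -(big_splits_size (fun j j' =>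
  us_egf (size a.1) j * us_egf (size a.2 + j')%N (size hi - (size (take p hi)).+1)%N)).
rewrite big_seq [RHS]big_seq; apply: eq_bigr => r /splits_subseq[r1 r2].
congr (_ * _); rewrite (drop_nth 0%N) // catA us_count_egf ?size_cat ?size_drop ?sp //.
apply: subseq_sorted ss; first exact: ltn_trans.
rewrite -catA cat_subseq // -drop_nth //; apply: subseq_trans (subseq_cons hi x).
by rewrite -[X in subseq _ X](cat_take_drop p hi) cat_subseq.
Qed.

Lemma count_us_pairs_second :
  (count (fun q => head 0%N q.2 == x) (us_pairs (lo ++ x :: hi)))%:R
    = (egf_sub (egf_mul (egf_t us_total) us_egf) (egf_mul (egf_x us_total)
      us_egf)) (size lo) (size hi).
Proof.
have [lox xhi] := pivot_bounds.
pose G u v : int := ((size (us_words u))%:R - (all (fun z =>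
  z < x)%N u)%:R * (size (us_words u))%:R)
  * (us_count v x)%:R.
transitivity (\sum_(c <- splits (lo ++ x :: hi)) G c.1 c.2).
  rewrite count_us_pairs // big_seq [RHS]big_seq; apply: eq_bigr => c cs; rewrite /G.
  rewrite -{1}[(size _)%:R]mul1r -mulrBl -[size (us_words c.1)]sum1_size natr_sum
    mulr_sumr mulr_suml.
  apply: eq_bigr => a _; rewrite /us_count count_sumr mulr_sumr; apply: eq_bigr => b _ /=.
  by case: eqP => [->|_]; case: (all _ _) => /=; ring.
rewrite big_splits_cat.
under eq_bigr => a _ do
  rewrite (big_splits_cons (fun u v => G (a.1 ++ u) (a.2 ++ v))).
pose g (a b : seq nat * seq nat) : int :=
  us_total (size a.1 + size b.1) * us_egf (size a.2) (size b.2).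
pose h (a b : seq nat * seq nat) : int :=
  egf_x us_total (size a.1) (size b.1) * us_egf (size a.2) (size b.2).
transitivity (\sum_(a <- splits lo) \sum_(b <- splits hi) (g a b - h a b)).
  rewrite big_seq [RHS]big_seq; apply: eq_bigr => a /splits_subseq[a1 a2].
  rewrite -big_split big_seq [RHS]big_seq; apply: eq_bigr => b /splits_subseq[b1 b2] /=.
  have sub1 : subseq (a.1 ++ b.1) (lo ++ x :: hi).
    by rewrite cat_subseq // (subseq_trans b1) // subseq_cons.
  have sub2 : subseq (a.2 ++ x :: b.2) (lo ++ x :: hi) by rewrite cat_subseq //= eqxx.
  have so1 := subseq_sorted ltn_trans sub1 ss;
    have so2 := subseq_sorted ltn_trans sub2 ss.
  have nx : x \notin a.2 ++ b.2.
    by have := sorted_uniq ltn_trans ltnn so2;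
      rewrite uniq_catC cons_uniq mem_cat orbC -mem_cat => /andP[].
  rewrite [X in X + _]/G (us_count_notin nx) mulr0 add0r.
  rewrite /G us_count_egf // size_us_words // size_cat /g /h -mulrBl; congr ((_ - _) * _).
  rewrite all_cat (_ : all _ a.1) /=; last first.
    by apply/allP => z /(mem_subseq a1)/(allP lox).
  (* One letter of [hi] in A cancels the subtracted term, just as [egf_x] vanishes at positive
     u-degree. *)
  case: (b.1) b1 => [|y t] b1; first by rewrite addn0 mul1r.
  have : (x < y)%N by apply: (allP xhi); apply: (mem_subseq b1); rewrite mem_head.
  by move=> xy; rewrite /= ltnNge ltnW // mul0r.
under eq_bigr => a _ do rewrite sumrB.
by rewrite sumrB egf_subE !egf_mul_splits.
Qed.

End Pairs.

Lemma iota_rcons m n : iota m n.+1 = rcons (iota m n) (m + n).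
Proof. by rewrite -addn1 iotaD cats1. Qed.

Lemma iota_pivot m i j : iota m (i + j).+1 = iota m i ++ (m + i)%N :: iota (m + i).+1 j.
Proof. by rewrite -addnS iotaD. Qed.

Lemma head_split A B m : us_word A -> head 0%N (A ++ rcons B m) = head 0%N A.
Proof. by move/us_word_neq0; case: A. Qed.

(** With no letter above it, the first letter is the largest, whereas a longer uniquely sorted word
    has its largest letter last. *)
Lemma us_egf_0 i : us_egf i 0%N = (i == 0%N)%:R.
Proof.
rewrite /us_egf addn0; case: i => [|i]; last first.
  rewrite (_ : us_count _ _ = 0%N) //; apply/eqP; rewrite -leqn0 leqNgt -has_count.
  apply/hasPn => w /us_wordsP[uw pw]; apply/eqP;
    case: uw pw => [x|A B m uA uB des ltm] pw.
    by have := perm_size pw; rewrite size_iota.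
  have ms : m \in iota 0 i.+2 by rewrite -(perm_mem pw) mem_cat mem_rcons mem_head orbT.
  rewrite head_split // => e; move: ms; rewrite mem_iota => /andP[_];
    rewrite add0n ltnS -e.
  have hA : head 0%N A \in A ++ B.
    by rewrite mem_cat; have := us_word_neq0 uA; case: (A) => //= *; rewrite mem_head.
  by rewrite leqNgt (allP ltm).
have e1 : us_words (iota 0 1) = [:: [:: 0%N]].
  by rewrite /us_words /= asboolT //; apply: us_word1.
by rewrite /us_count e1.
Qed.

(** d/du adds a largest letter m, and A B m has the same first letter as A. *)
Lemma us_egf_du : egf_du us_egf =
  egf_sub (egf_mul (egf_t us_total) us_egf) (egf_int us_egf us_egf).
Proof.
apply: egfP => i j; rewrite -{2}(size_iota 0 i) -[in RHS](size_iota i.+1 j).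
have e : iota 0 (i + j).+1 = iota 0 i ++ i :: iota i.+1 j by exact: iota_pivot.
have ss : sorted ltn (iota 0 i ++ i :: iota i.+1 j) by rewrite -e iota_ltn_sorted.
rewrite -(count_us_pairs_first ss) /egf_du /us_egf -e addnS; congr (_%:R).
rewrite iota_rcons /us_count (seq.permP (us_words_rcons _ _)) // -?iota_rcons
  ?iota_ltn_sorted //.
rewrite count_map; apply: eq_in_count => q /(us_pairsP _ (iota_uniq _ _))[uA _ _ _] /=.
by rewrite head_split.
Qed.

Lemma us_egf_dx : egf_dx us_egf =
  egf_sub (egf_mul (egf_t us_total) us_egf) (egf_mul (egf_x us_total) us_egf).
Proof. exact: riccati_dx us_egf_0 us_egf_du. Qed.

Lemma us_word_head_gt w : us_word w -> (1 < size w)%N -> (nth 0%N w 1 < head 0%N w)%N.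
Proof.
move=> /us_word_steps[pw _]; have := pw 1%N.
by case: w pw => [|x [|y s]] //=; rewrite take0 /=; case: ltnP.
Qed.

Lemma us_egf_0j j : us_egf 0 j.+1 = 0.
Proof.
rewrite /us_egf (_ : us_count _ _ = 0%N) //; apply/eqP; rewrite -leqn0 leqNgt -has_count.
apply/hasPn => w /us_wordsP[uw pw]; have := us_word_head_gt uw.
by rewrite (perm_size pw) size_iota => /(_ isT); case: (head 0%N w).
Qed.
End Enumeration.

Lemma count_first_entry k l : (1 <= l <= k.+1)%N ->
  ((count (fun w => `[< us_word w >] && (head 0%N w == l)) (permutations (iota 1
    k.+1)))%:R
    = us_egf (l - 1)%N (k.+1 - l)%N :> int)%R.
Proof.
move=> hl; have ek : k = (l - 1 + (k.+1 - l))%N by lia.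
have el : (1 + (l - 1) = l)%N by lia.
have e : iota 1 k.+1 = iota 1 (l - 1) ++ l :: iota l.+1 (k.+1 - l).
  by rewrite {1}ek iota_pivot el.
have ss : sorted ltn (iota 1 (l - 1) ++ l :: iota l.+1 (k.+1 - l))
  by rewrite -e iota_ltn_sorted.
have := us_count_egf ss; rewrite !size_iota -e => <-.
by rewrite /us_count count_filter; congr (_%:R)%R; apply: eq_count => w /=; rewrite andbC.
Qed.

Lemma count_us_eye (R : realType) n e : (1 <= n)%N ->
  #|[pred p : 'S_n.+1 | uniquely_sorted p & `[< is_eye R p e >]]|
  = count (fun q => head 0 q.2 == e) (us_pairs (iota 1 n)).
Proof.
move=> n0.
pose Q w := `[< exists A B m, [/\ us_word A, us_word B, (head 0 B < last 0 A)%N,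
  all (fun x => x < m)%N (A ++ B) & w = A ++ rcons B m] /\ e = head 0 B >].
rewrite (eq_card (B := [pred p : 'S_n.+1 | [pred w | `[< us_word w >] && Q w]
  (word p)])); last first.
  move=> p; rewrite !inE uniquely_sortedE //; case: (asboolP (us_word _)) => //= uw.
  case: {-2}(word p) / uw (erefl (word p)) => [x|A B m uA uB des ltm] ew.
    by have := size_word p; rewrite -ew /=; lia.
  apply/asboolP/asboolP => [eye|[A' [B' [m' [[uA' uB' des' ltm' ew'] ->]]]]].
    by exists A, B, m; split; last by apply/(is_eyeE R e uA uB des ltm (esym ew)).
  by apply/(is_eyeE R _ uA' uB' des' ltm' (etrans (esym ew) ew')).
rewrite card_words (eq_count (a2 := [predI Q & fun w => `[< us_word w >]])); last first.
  by move=> w /=; rewrite andbC.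
rewrite -count_filter -/(us_words _) iota_rcons.
have ss : sorted ltn (rcons (iota 1 n) (1 + n)) by rewrite -iota_rcons iota_ltn_sorted.
rewrite (seq.permP (us_words_rcons _ ss)); last by case: (n) n0.
rewrite count_map; apply: eq_in_count =>
  q /(us_pairsP _ (iota_uniq _ _))[uA uB des pAB] /=.
apply/asboolP/eqP => [[A [B [m [[uA' uB' des' _ e'] ->]]]]|<-].
  by have [_ ->] := us_word_split_inj uA uB des uA' uB' e'.
exists q.1, q.2, (1 + n)%N; split=> //; split=> //.
by rewrite (perm_all _ pAB); apply/allP => x; rewrite mem_iota => /andP[].
Qed.

Theorem theorem5p8 (R : realType) (k l : nat) (hk : (1 <= k)%N)
    (hl : (1 <= l <= 2 * k + 1)%N) :
  #|[pred p : 'S_(2 * k + 1) | uniquely_sorted p & `[< is_eye R p (l - 1) >]]|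
  = A k.+1 l.
Proof.
have inj (a b : nat) : (a%:R = b%:R :> int)%R -> a = b.
  by move/eqP; rewrite !pmulrn eqr_int => /eqP[].
apply: inj; rewrite /A; move: hl; rewrite addn1 => hl.
rewrite count_us_eye; last by lia.
rewrite (eq_card (B := [pred p : 'S_(2 * k).+1 |
    [pred w | `[< us_word w >] && (head 0%N w == l)] (word p)])); last first.
  by move=> p; rewrite !inE uniquely_sortedE.
rewrite card_words count_first_entry //.
case: l hl => [|[|i]] // hi.
  (* The case [l = 1]: both counts are 0, as a uniquely sorted word of length above 1 starts with a
     descent and no entry is 0. *)
  rewrite (_ : (2 * k).+1 - 1 = (2 * k).-1.+1)%N ?us_egf_0j; last by lia.
  rewrite (_ : count _ _ = 0%N) //; apply/eqP; rewrite -leqn0 leqNgt -has_count.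
  apply/hasPn => q /(us_pairsP _ (iota_uniq _ _))[_ uB _ pAB].
  have : head 0 q.2 \in iota 1 (2 * k).
    by rewrite -(perm_mem pAB) mem_cat; have := us_word_neq0 uB;
      case: (q.2) => //= *; rewrite mem_head orbT.
  by rewrite mem_iota; case: (head 0 q.2).
(* Without the largest letter, the eye [i.+1] has [i] smaller letters in 1..2k and as many larger
   ones as the first entry [i.+2] has in 1..2k+1. The extra smaller letter of the latter is the
   shift [egf_dx]. *)
have eS : (i.+2 - 1 = i.+1)%N by lia.
have e : iota 1 (2 * k) = iota 1 i ++ i.+1 :: iota i.+2 ((2 * k).+1 - i.+2).
  by rewrite -iota_pivot; congr iota; lia.
have ss : sorted ltn (iota 1 i ++ i.+1 :: iota i.+2 ((2 * k).+1 - i.+2)).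
  by rewrite -e iota_ltn_sorted.
by rewrite eS e (count_us_pairs_second ss) !size_iota -us_egf_dx.
Qed.
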